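(* Let $\mathcal{O}$ be a complete discrete valuation ring with fraction field $\mathcal{K}$, let $A$ be a Gorenstein $\mathcal{O}$-order, let $M$ be an indecomposable non-projective $A$-lattice such that $M\otimes\mathcal{K}$ is projective as an $A\otimes\mathcal{K}$-module, and let $p:P\to M$ be its projective cover. Let $L=D(\operatorname{Coker}(\operatorname{Hom}_A(p,A)))$, so that there is an exact sequence of $A$-lattices $0\to L\to\nu(P)\xrightarrow{\nu(p)}\nu(M)\to 0$. For $\varphi\in\operatorname{Hom}_A(M,\nu(M))$, let $$0\to L\to E\to M\to 0$$ be the pullback of this exact sequence along $\varphi$. Then the following are equivalent. (1) The pullback $0\to L\to E\to M\to 0$ is an almost split sequence. (2) The following three conditions hold: (i) $\varphi$ does not factor through $\nu(p)$; (ii) $L$ is an indecomposable $A$-lattice; (iii) for all $f\in\operatorname{Rad}\operatorname{End}_A(M)$, $\varphi f$ factors through $\nu(p)$.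
   Context: An $\mathcal{O}$-order is an $\mathcal{O}$-algebra that is free of finite rank as an $\mathcal{O}$-module; an $A$-lattice is an $A$-module free of finite rank over $\mathcal{O}$. $A$ is a Gorenstein $\mathcal{O}$-order if $\operatorname{Hom}_{\mathcal O}(A_A,\mathcal{O})$ is a projective $A$-module. $D=\operatorname{Hom}_{\mathcal O}(-,\mathcal{O})$ and $\nu=D(\operatorname{Hom}_A(-,A))$ is the Nakayama functor for $A$-lattices. $\operatorname{Rad}\operatorname{Hom}_A(M,N)$ is the set of $f\in\operatorname{Hom}_A(M,N)$ such that, for all indecomposable $A$-lattices $X$, all $g\in\operatorname{Hom}_A(X,M)$ and $h\in\operatorname{Hom}_A(N,X)$, one has $hfg\in\operatorname{Rad}\operatorname{End}_A(X)$ (equivalently, $1-gf$ is invertible for all $g\in\operatorname{Hom}_A(N,M)$). $\operatorname{Rad}\operatorname{End}_A(M)$ is the Jacobson radical. A short exact sequence of $A$-lattices $0\to L\to E\xrightarrow{q}M\to 0$ is an almost split sequence (ending at $M$) if: the epimorphism $q$ does not split; $L$ and $M$ are indecomposable; and for every indecomposable $A$-lattice $X$, composition with $q$ induces an epimorphism $\operatorname{Hom}_A(X,E)\to\operatorname{Rad}\operatorname{Hom}_A(X,M)$. *)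

(* Defs.v *)
From HB Require Import structures.
From mathcomp Require Import all_boot all_order all_algebra.
From mathcomp Require Import boolp classical_sets.
Set Implicit Arguments.
Unset Strict Implicit.
Unset Printing Implicit Defensive.
Import GRing.Theory.
Local Open Scope ring_scope.
Local Open Scope quotient_scope.
Local Open Scope classical_set_scope.

(* Conventions: modules are left modules; right A-modules are modules over the
   converse ring A^c. *)

Section HomZmodule.
Variables (R : pzRingType) (U V : lmodType R).

HB.instance Definition _ := gen_eqMixin {linear U -> V}.
HB.instance Definition _ := gen_choiceMixin {linear U -> V}.

Implicit Types f g h : {linear U -> V}.

Lemma lin_ext f g : f =1 g -> f = g.
Proof.
case: f g => [f [[fD0] [fZ]]] [g [[gD0] [gZ]]] /= /funext fg; subst g.
by congr GRing.Linear.Pack; congr GRing.Linear.Class;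
   [congr GRing.isNmodMorphism.Axioms_ | congr GRing.isScalable.Axioms_];
   exact: Prop_irrelevance.
Qed.

Definition lin_zero : {linear U -> V} := \0.
Definition lin_opp f : {linear U -> V} := \- f.
Definition lin_add f g : {linear U -> V} := f \+ g.

Fact lin_addA : associative lin_add.
Proof. by move=> f g h; apply: lin_ext => x /=; rewrite addrA. Qed.
Fact lin_addC : commutative lin_add.
Proof. by move=> f g; apply: lin_ext => x /=; rewrite addrC. Qed.
Fact lin_add0 : left_id lin_zero lin_add.
Proof. by move=> f; apply: lin_ext => x /=; rewrite add0r. Qed.
Fact lin_addN : left_inverse lin_zero lin_opp lin_add.
Proof. by move=> f; apply: lin_ext => x /=; rewrite addNr. Qed.

HB.instance Definition _ :=
  GRing.isZmodule.Build {linear U -> V} lin_addA lin_addC lin_add0 lin_addN.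
End HomZmodule.

Definition lin_comp (R : pzRingType) (U V W : lmodType R)
  (g : {linear V -> W}) (f : {linear U -> V}) : {linear U -> W} := g \o f.

Definition lin_id (R : pzRingType) (U : lmodType R) : {linear U -> U} := idfun.

Section EndRing.
Variables (R : pzRingType) (U : lmodType R).
Implicit Types f g h : {linear U -> U}.

Fact lin_compA : associative (@lin_comp R U U U).
Proof. by move=> f g h; apply: lin_ext. Qed.
Fact lin_comp1l : left_id (lin_id U) (@lin_comp R U U U).
Proof. by move=> f; apply: lin_ext. Qed.
Fact lin_comp1r : right_id (lin_id U) (@lin_comp R U U U).
Proof. by move=> f; apply: lin_ext. Qed.
Fact lin_compDl : left_distributive (@lin_comp R U U U) +%R.
Proof. by move=> f g h; apply: lin_ext. Qed.
Fact lin_compDr : right_distributive (@lin_comp R U U U) +%R.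
Proof. by move=> f g h; apply: lin_ext => x /=; rewrite linearD. Qed.

HB.instance Definition _ := GRing.Zmodule_isPzRing.Build {linear U -> U}
  lin_compA lin_comp1l lin_comp1r lin_compDl lin_compDr.
End EndRing.

Section ConverseAlgebra.
Variables (O : comNzRingType) (A : algType O).

Definition conv_scale (c : O) (x : A^c) : A^c := c *: (x : A).

Fact conv_scaleA a b x : conv_scale a (conv_scale b x) = conv_scale (a * b) x.
Proof. exact: (@scalerA O A). Qed.
Fact conv_scale1 : left_id 1 conv_scale.
Proof. exact: (@scale1r O A). Qed.
Fact conv_scaleDr : right_distributive conv_scale +%R.
Proof. exact: (@scalerDr O A). Qed.
Fact conv_scaleDl x : {morph conv_scale^~ x : a b / a + b}.
Proof. move=> a b; exact: (@scalerDl O A). Qed.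
HB.instance Definition _ := GRing.Zmodule_isLmodule.Build O A^c
  conv_scaleA conv_scale1 conv_scaleDr conv_scaleDl.

Fact conv_scaleAl (c : O) (x y : A^c) : c *: (x * y) = (c *: x : A^c) * y.
Proof. exact: (@scalerAr O A c y x). Qed.
HB.instance Definition _ := GRing.Lmodule_isLalgebra.Build O A^c conv_scaleAl.

Fact conv_scaleAr (c : O) (x y : A^c) : c *: (x * y) = x * (c *: y : A^c).
Proof. exact: (@scalerAl O A c y x). Qed.
HB.instance Definition _ := GRing.Lalgebra_isAlgebra.Build O A^c conv_scaleAr.
End ConverseAlgebra.

(* The O-module underlying an A-module. *)
Definition restrict (O : comNzRingType) (A : algType O) (M : lmodType A) : Type :=
  M.

Section Restrict.
Variables (O : comNzRingType) (A : algType O) (M : lmodType A).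

HB.instance Definition _ := GRing.Zmodule.on (restrict M).

Definition restrict_scale (c : O) (x : restrict M) : restrict M :=
  (c%:A : A) *: (x : M).

Fact restrict_scaleA a b x :
  restrict_scale a (restrict_scale b x) = restrict_scale (a * b) x.
Proof. by rewrite /restrict_scale scalerA -scalerAl mul1r scalerA. Qed.
Fact restrict_scale1 : left_id 1 restrict_scale.
Proof. by move=> x; rewrite /restrict_scale !scale1r. Qed.
Fact restrict_scaleDr : right_distributive restrict_scale +%R.
Proof. by move=> c x y; rewrite /restrict_scale scalerDr. Qed.
Fact restrict_scaleDl x : {morph restrict_scale^~ x : a b / a + b}.
Proof. by move=> a b; rewrite /restrict_scale !scalerDl. Qed.

HB.instance Definition _ := GRing.Zmodule_isLmodule.Build O (restrict M)
  restrict_scaleA restrict_scale1 restrict_scaleDr restrict_scaleDl.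
End Restrict.

(* Hom_A(M, A), a right A-module via (f . a)(m) = f(m) a. *)
Definition Adual (A : nzRingType) (M : lmodType A) : Type := {linear M -> A^o}.

Section Adual.
Variables (A : nzRingType) (M : lmodType A).

HB.instance Definition _ := GRing.Zmodule.on (Adual M).

Section Scale.
Variables (a : A^c) (f : {linear M -> A^o}).
Definition Adual_scale_fun (x : M) : A^o := (f x : A) * (a : A).
Fact Adual_scale_linear : linear Adual_scale_fun.
Proof.
move=> b x y; rewrite /Adual_scale_fun linearP.
by rewrite [LHS](mulrDl (b * f x) (f y) (a : A)) -mulrA.
Qed.
HB.instance Definition _ :=
  GRing.isLinear.Build A M A^o *:%R Adual_scale_fun Adual_scale_linear.
Definition Adual_scale : Adual M := Adual_scale_fun : {linear M -> A^o}.
End Scale.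

Fact Adual_scaleA a b f :
  Adual_scale a (Adual_scale b f) = Adual_scale (a * b) f.
Proof.
by apply: lin_ext => x; rewrite /= /Adual_scale_fun /= /Adual_scale_fun -mulrA.
Qed.
Fact Adual_scale1 : left_id 1 Adual_scale.
Proof.
by move=> f; apply: lin_ext => x; rewrite /= /Adual_scale_fun [LHS]mulr1.
Qed.
Fact Adual_scaleDr : right_distributive Adual_scale (+%R : _ -> _ -> Adual M).
Proof.
by move=> a f g; apply: lin_ext => x; rewrite /= /Adual_scale_fun [LHS]mulrDl.
Qed.
Fact Adual_scaleDl f :
  {morph Adual_scale^~ f : a b / a + b >-> (a + b : Adual M)}.
Proof.
by move=> a b; apply: lin_ext => x; rewrite /= /Adual_scale_fun [LHS]mulrDr.
Qed.

HB.instance Definition _ := GRing.Zmodule_isLmodule.Build A^c (Adual M)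
  Adual_scaleA Adual_scale1 Adual_scaleDr Adual_scaleDl.
End Adual.

Section AdualMap.
Variables (A : nzRingType) (M N : lmodType A) (p : {linear M -> N}).

Definition Adual_map_fun (f : Adual N) : Adual M :=
  lin_comp (f : {linear N -> A^o}) p.
Fact Adual_map_linear : linear Adual_map_fun.
Proof. by move=> a f g; apply: lin_ext. Qed.
HB.instance Definition _ := GRing.isLinear.Build A^c (Adual N) (Adual M) *:%R
  Adual_map_fun Adual_map_linear.

(* Hom_A(p, A). *)
Definition Adual_map : {linear Adual N -> Adual M} := Adual_map_fun.
End AdualMap.

(* D(N) = Hom_O(N, O) for a right A-module N, a left A-module via
   (a . xi)(n) = xi(n a). *)
Definition D (O : comNzRingType) (A : algType O) (N : lmodType A^c) : Type :=
  {linear restrict N -> O^o}.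

Section D.
Variables (O : comNzRingType) (A : algType O) (N : lmodType A^c).

HB.instance Definition _ := GRing.Zmodule.on (D N).

Section Scale.
Variables (a : A) (xi : {linear restrict N -> O^o}).
Definition D_scale_fun (n : restrict N) : O^o := xi ((a : A^c) *: (n : N)).
Fact D_scale_linear : linear D_scale_fun.
Proof.
move=> c x y; rewrite /D_scale_fun -linearP; congr (xi _).
rewrite [LHS]scalerDr; congr (_ + _).
rewrite [LHS]scalerA [RHS]scalerA.
apply: (congr1 (fun b : A^c => b *: (x : N))).
by rewrite -scalerAr -scalerAl mul1r mulr1.
Qed.
HB.instance Definition _ :=
  GRing.isLinear.Build O (restrict N) O^o *:%R D_scale_fun D_scale_linear.
Definition D_scale : D N := D_scale_fun : {linear restrict N -> O^o}.
End Scale.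

Fact D_scaleA a b xi : D_scale a (D_scale b xi) = D_scale (a * b) xi.
Proof.
by apply: lin_ext => x; rewrite /= /D_scale_fun /= /D_scale_fun scalerA.
Qed.
Fact D_scale1 : left_id 1 D_scale.
Proof.
by move=> f; apply: lin_ext => x; rewrite /= /D_scale_fun [_ *: _]scale1r.
Qed.
Fact D_scaleDr : right_distributive D_scale (+%R : _ -> _ -> D N).
Proof. by move=> a f g; apply: lin_ext. Qed.
Fact D_scaleDl xi : {morph D_scale^~ xi : a b / a + b >-> (a + b : D N)}.
Proof.
move=> a b; apply: lin_ext => x.
by rewrite /= /D_scale_fun [_ *: _]scalerDl [LHS]linearD.
Qed.

HB.instance Definition _ := GRing.Zmodule_isLmodule.Build A (D N)
  D_scaleA D_scale1 D_scaleDr D_scaleDl.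
End D.

Section DMap.
Variables (O : comNzRingType) (A : algType O) (N N' : lmodType A^c).
Variable u : {linear N -> N'}.

Section Apply.
Variable xi : {linear restrict N' -> O^o}.
Definition D_map_app (n : restrict N) : O^o := xi (u n).
Fact D_map_app_linear : linear D_map_app.
Proof.
move=> c x y; rewrite /D_map_app -linearP; congr (xi _).
by rewrite [LHS]linearD [u _]linearZ.
Qed.
HB.instance Definition _ :=
  GRing.isLinear.Build O (restrict N) O^o *:%R D_map_app D_map_app_linear.
End Apply.

Definition D_map_fun (xi : D N') : D N :=
  D_map_app xi : {linear restrict N -> O^o}.
Fact D_map_linear : linear D_map_fun.
Proof.
move=> a f g; apply: lin_ext => x.
by rewrite /= /D_map_app /= /D_scale_fun linearZ.
Qed.
HB.instance Definition _ :=
  GRing.isLinear.Build A (D N') (D N) *:%R D_map_fun D_map_linear.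

(* D(u) : D(N') -> D(N). *)
Definition D_map : {linear D N' -> D N} := D_map_fun.
End DMap.

(* The Nakayama functor. *)
Definition nu (O : comNzRingType) (A : algType O) (M : lmodType A) :
  lmodType A := D (Adual M).

Definition nu_map (O : comNzRingType) (A : algType O) (M N : lmodType A)
  (p : {linear M -> N}) : {linear nu M -> nu N} := D_map (Adual_map p).

(* The cokernel V / u(U) of u : U -> V. *)
Section Cokernel.
Variables (R : pzRingType) (U V : lmodType R) (u : {linear U -> V}).

Definition coker_rel (x y : V) : bool := `[< exists w : U, x - y = u w >].

Fact coker_relP x y : reflect (exists w : U, x - y = u w) (coker_rel x y).
Proof. exact: asboolP. Qed.
Fact coker_rel_refl : reflexive coker_rel.
Proof. by move=> x; apply/coker_relP; exists 0; rewrite subrr linear0. Qed.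
Fact coker_rel_sym : symmetric coker_rel.
Proof.
move=> x y; apply/coker_relP/coker_relP => -[w xy]; exists (- w);
  by rewrite linearN -xy opprB.
Qed.
Fact coker_rel_trans : transitive coker_rel.
Proof.
move=> y x z /coker_relP[w xy] /coker_relP[w' yz]; apply/coker_relP.
by exists (w + w'); rewrite linearD -xy -yz addrA subrK.
Qed.
Canonical coker_equiv :=
  EquivRel coker_rel coker_rel_refl coker_rel_sym coker_rel_trans.

Definition coker : Type := {eq_quot coker_rel}.
HB.instance Definition _ : EqQuotient _ coker_rel coker := EqQuotient.on coker.
HB.instance Definition _ := Choice.on coker.

Definition coker_class (x : V) : coker := \pi x.

Fact coker_classP x y : coker_class x = coker_class y <-> exists w, x - y = u w.
Proof.
by split=> [/eqmodP /coker_relP // | ?]; apply/eqmodP/coker_relP.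
Qed.

Definition coker_zero : coker := coker_class 0.
Definition coker_opp (x : coker) : coker := coker_class (- repr x).
Definition coker_add (x y : coker) : coker := coker_class (repr x + repr y).
Definition coker_scale (a : R) (x : coker) : coker := coker_class (a *: repr x).

Fact coker_ind (P : coker -> Prop) : (forall x, P (coker_class x)) ->
  forall x, P x.
Proof. by move=> Pc x; rewrite -[x]reprK; apply: Pc. Qed.

Fact coker_repr x : exists w, repr (coker_class x) - x = u w.
Proof. by apply/coker_classP; rewrite /coker_class reprK. Qed.

Fact coker_oppE x : coker_opp (coker_class x) = coker_class (- x).
Proof.
apply/coker_classP; have [w xw] := coker_repr x.
by exists (- w); rewrite [RHS]linearN -xw opprB opprK addrC.
Qed.
Fact coker_addE x y :
  coker_add (coker_class x) (coker_class y) = coker_class (x + y).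
Proof.
apply/coker_classP; have [w xw] := coker_repr x; have [w' yw] := coker_repr y.
by exists (w + w'); rewrite [RHS]linearD -xw -yw opprD addrACA.
Qed.
Fact coker_scaleE a x : coker_scale a (coker_class x) = coker_class (a *: x).
Proof.
apply/coker_classP; have [w xw] := coker_repr x.
by exists (a *: w); rewrite [RHS]linearZZ -xw scalerBr.
Qed.

Fact coker_addA : associative coker_add.
Proof.
elim/coker_ind=> x; elim/coker_ind=> y; elim/coker_ind=> z.
by rewrite !coker_addE addrA.
Qed.
Fact coker_addC : commutative coker_add.
Proof.
by elim/coker_ind=> x; elim/coker_ind=> y; rewrite !coker_addE addrC.
Qed.
Fact coker_add0 : left_id coker_zero coker_add.
Proof. by elim/coker_ind=> x; rewrite coker_addE add0r. Qed.
Fact coker_addN : left_inverse coker_zero coker_opp coker_add.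
Proof. by elim/coker_ind=> x; rewrite coker_oppE coker_addE addNr. Qed.
HB.instance Definition _ := GRing.isZmodule.Build coker
  coker_addA coker_addC coker_add0 coker_addN.

Fact coker_scaleA a b x :
  coker_scale a (coker_scale b x) = coker_scale (a * b) x.
Proof. by elim/coker_ind: x => x; rewrite !coker_scaleE scalerA. Qed.
Fact coker_scale1 : left_id 1 coker_scale.
Proof. by elim/coker_ind=> x; rewrite coker_scaleE scale1r. Qed.
Fact coker_scaleDr : right_distributive coker_scale +%R.
Proof.
move=> a; elim/coker_ind=> x; elim/coker_ind=> y.
by rewrite [_ + _]coker_addE !coker_scaleE [RHS]coker_addE scalerDr.
Qed.
Fact coker_scaleDl x : {morph coker_scale^~ x : a b / a + b}.
Proof.
elim/coker_ind: x => x a b.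
by rewrite !coker_scaleE [RHS]coker_addE scalerDl.
Qed.
HB.instance Definition _ := GRing.Zmodule_isLmodule.Build R coker
  coker_scaleA coker_scale1 coker_scaleDr coker_scaleDl.

Fact coker_class_linear : linear coker_class.
Proof.
by move=> a x y; rewrite [_ *: _ in RHS]coker_scaleE [RHS]coker_addE.
Qed.
HB.instance Definition _ :=
  GRing.isLinear.Build R V coker *:%R coker_class coker_class_linear.

Definition coker_proj : {linear V -> coker} := coker_class.
End Cokernel.

(* M (x)_O N: formal sums of pairs (m, n) -- standing for m (x) n -- where two
   sums are identified when no bilinear map on M x N separates them. *)
Section Tensor.
Variables (O : nzRingType) (M N : lmodType O).

Definition pairing (Z : lmodType O) (b : M -> N -> Z) (s : seq (M * N)) : Z :=
  \sum_(x <- s) b x.1 x.2.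

Definition tens_rel (s t : seq (M * N)) : bool :=
  `[< forall (Z : lmodType O) (b : M -> N -> Z),
        bilinear_for *:%R *:%R b -> pairing b s = pairing b t >].

Fact tens_relP s t :
  reflect (forall (Z : lmodType O) (b : M -> N -> Z),
             bilinear_for *:%R *:%R b -> pairing b s = pairing b t)
          (tens_rel s t).
Proof. exact: asboolP. Qed.
Fact tens_rel_refl : reflexive tens_rel.
Proof. by move=> s; apply/tens_relP. Qed.
Fact tens_rel_sym : symmetric tens_rel.
Proof. by move=> s t; apply/tens_relP/tens_relP => st Z b /st. Qed.
Fact tens_rel_trans : transitive tens_rel.
Proof.
move=> t s r /tens_relP st /tens_relP tr; apply/tens_relP => Z b bb.
by rewrite st // tr.
Qed.
Canonical tens_equiv :=
  EquivRel tens_rel tens_rel_refl tens_rel_sym tens_rel_trans.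

Definition tens : Type := {eq_quot tens_rel}.
HB.instance Definition _ : EqQuotient _ tens_rel tens := EqQuotient.on tens.
HB.instance Definition _ := Choice.on tens.

Definition tens_class (s : seq (M * N)) : tens := \pi s.

Definition tens_pure (m : M) (n : N) : tens := tens_class [:: (m, n)].

Fact tens_classP s t : tens_class s = tens_class t <->
  forall (Z : lmodType O) (b : M -> N -> Z),
    bilinear_for *:%R *:%R b -> pairing b s = pairing b t.
Proof. by split=> [/eqmodP /tens_relP // | ?]; apply/eqmodP/tens_relP. Qed.

Definition tens_zero : tens := tens_class [::].
Definition tens_opp (x : tens) : tens :=
  tens_class [seq (- p.1, p.2) | p <- repr x].
Definition tens_add (x y : tens) : tens := tens_class (repr x ++ repr y).

Fact tens_ind (P : tens -> Prop) : (forall s, P (tens_class s)) ->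
  forall x, P x.
Proof. by move=> Pc x; rewrite -[x]reprK; apply: Pc. Qed.

Fact tens_repr s (Z : lmodType O) (b : M -> N -> Z) :
  bilinear_for *:%R *:%R b -> pairing b (repr (tens_class s)) = pairing b s.
Proof. by move: Z b; apply/tens_classP; rewrite /tens_class reprK. Qed.

Fact pairing_opp (Z : lmodType O) (b : M -> N -> Z) s :
  bilinear_for *:%R *:%R b ->
  pairing b [seq (- p.1, p.2) | p <- s] = - pairing b s.
Proof.
move=> [bl br]; rewrite /pairing big_map -sumrN; apply: eq_bigr => -[m n] _ /=.
have b0 : b 0 n = 0.
  by have := zmod_morphism_linear (bl n) 0 0; rewrite !subr0 subrr.
by have := zmod_morphism_linear (bl n) 0 m; rewrite /= b0 !sub0r.
Qed.

Fact pairing_cat (Z : lmodType O) (b : M -> N -> Z) s t :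
  pairing b (s ++ t) = pairing b s + pairing b t.
Proof. exact: big_cat. Qed.

Fact tens_oppE s :
  tens_opp (tens_class s) = tens_class [seq (- p.1, p.2) | p <- s].
Proof.
by apply/tens_classP => Z b bb; rewrite !pairing_opp // tens_repr.
Qed.
Fact tens_addE s t : tens_add (tens_class s) (tens_class t) = tens_class (s ++ t).
Proof. by apply/tens_classP => Z b bb; rewrite !pairing_cat !tens_repr. Qed.

Fact tens_addA : associative tens_add.
Proof.
by elim/tens_ind=> s; elim/tens_ind=> t; elim/tens_ind=> r;
   rewrite !tens_addE catA.
Qed.
Fact tens_addC : commutative tens_add.
Proof.
elim/tens_ind=> s; elim/tens_ind=> t; rewrite !tens_addE.
by apply/tens_classP => Z b bb; rewrite !pairing_cat addrC.
Qed.
Fact tens_add0 : left_id tens_zero tens_add.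
Proof. by elim/tens_ind=> s; rewrite tens_addE. Qed.
Fact tens_addN : left_inverse tens_zero tens_opp tens_add.
Proof.
elim/tens_ind=> s; rewrite tens_oppE tens_addE.
apply/tens_classP => Z b bb.
by rewrite pairing_cat pairing_opp // addNr /pairing big_nil.
Qed.
HB.instance Definition _ :=
  GRing.isZmodule.Build tens tens_addA tens_addC tens_add0 tens_addN.
End Tensor.

(* For bilinear op : U1 x V1 -> W1 and op' : U2 x V2 -> W2, the induced product
   (u1 (x) u2, v1 (x) v2) |-> op u1 v1 (x) op' u2 v2. *)
Section TensorProductMap.
Variables (O : comNzRingType) (U1 V1 W1 U2 V2 W2 : lmodType O).
Variables (op : U1 -> V1 -> W1) (op' : U2 -> V2 -> W2).

Definition seq_prod (s : seq (U1 * U2)) (t : seq (V1 * V2)) : seq (W1 * W2) :=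
  [seq (op x.1 y.1, op' x.2 y.2) | x <- s, y <- t].

Definition tens_prod (x : tens U1 U2) (y : tens V1 V2) : tens W1 W2 :=
  tens_class (seq_prod (repr x) (repr y)).

Fact pairing_prod (Z : lmodType O) (b : W1 -> W2 -> Z) s t :
  pairing b (seq_prod s t) =
  \sum_(x <- s) \sum_(y <- t) b (op x.1 y.1) (op' x.2 y.2).
Proof. by rewrite /pairing /seq_prod big_allpairs_dep. Qed.

Hypothesis op_bil : bilinear_for *:%R *:%R op.
Hypothesis op'_bil : bilinear_for *:%R *:%R op'.

Fact tens_prodE s t :
  tens_prod (tens_class s) (tens_class t) = tens_class (seq_prod s t).
Proof.
case: op_bil op'_bil => opl opr [op'l op'r].
apply/tens_classP => Z b [bl br]; rewrite !pairing_prod.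
pose b1 (r : seq (V1 * V2)) u1 u2 := \sum_(y <- r) b (op u1 y.1) (op' u2 y.2) : Z.
have b1_bil r : bilinear_for *:%R *:%R (b1 r).
  split=> u a v w; rewrite /b1 /= scaler_sumr -big_split; apply: eq_bigr => y _ /=.
    by rewrite opl bl.
  by rewrite op'l br.
rewrite -![LHS]/(pairing (b1 _) _) tens_repr // /pairing /b1.
rewrite exchange_big [RHS]exchange_big /=.
pose b2 v1 v2 := \sum_(x <- s) b (op x.1 v1) (op' x.2 v2) : Z.
have b2_bil : bilinear_for *:%R *:%R b2.
  split=> u a v w; rewrite /b2 /= scaler_sumr -big_split; apply: eq_bigr => y _ /=.
    by rewrite opr bl.
  by rewrite op'r br.
by rewrite -[LHS]/(pairing b2 _) tens_repr.
Qed.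

Fact tens_prodDl x x' y : tens_prod (x + x') y = tens_prod x y + tens_prod x' y.
Proof.
elim/tens_ind: x => s; elim/tens_ind: x' => s'; elim/tens_ind: y => t.
rewrite [_ + _ in LHS]tens_addE !tens_prodE [RHS]tens_addE.
by apply/tens_classP => Z b bb; rewrite pairing_cat !pairing_prod big_cat.
Qed.
Fact tens_prodDr x y y' : tens_prod x (y + y') = tens_prod x y + tens_prod x y'.
Proof.
elim/tens_ind: x => s; elim/tens_ind: y => t; elim/tens_ind: y' => t'.
rewrite [_ + _ in LHS]tens_addE !tens_prodE [RHS]tens_addE.
apply/tens_classP => Z b bb; rewrite pairing_cat !pairing_prod -big_split /=.
by apply: eq_bigr => x _; rewrite big_cat.
Qed.
End TensorProductMap.

(* The O-algebra A (x)_O B, with (a (x) b)(a' (x) b') = aa' (x) bb'. *)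
Section TensorAlgebra.
Variables (O : comNzRingType) (A B : algType O).

Fact mul_bilinear (C : algType O) : bilinear_for *:%R *:%R (@GRing.mul C).
Proof.
by split=> u a v w /=; [rewrite mulrDl scalerAl | rewrite mulrDr scalerAr].
Qed.

Definition tens_one : tens A B := tens_pure 1 1.
Definition tens_mul : tens A B -> tens A B -> tens A B :=
  tens_prod (@GRing.mul A) (@GRing.mul B).

Let mulE := tens_prodE (mul_bilinear A) (mul_bilinear B).

Fact tens_mulA : associative tens_mul.
Proof.
elim/tens_ind=> s; elim/tens_ind=> t; elim/tens_ind=> r.
rewrite /tens_mul (mulE t r) (mulE s t) !mulE; apply/tens_classP => Z b bb; rewrite !pairing_prod.
rewrite [RHS]big_allpairs_dep; apply: eq_bigr => x _.
rewrite [LHS]big_allpairs_dep; apply: eq_bigr => y _ /=.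
by apply: eq_bigr => z _; rewrite !mulrA.
Qed.
Fact tens_mul1l : left_id tens_one tens_mul.
Proof.
elim/tens_ind=> s; rewrite /tens_mul mulE; apply/tens_classP => Z b bb.
rewrite pairing_prod big_seq1; apply: eq_bigr => x _.
by rewrite !mul1r.
Qed.
Fact tens_mul1r : right_id tens_one tens_mul.
Proof.
elim/tens_ind=> s; rewrite /tens_mul mulE; apply/tens_classP => Z b bb.
rewrite pairing_prod; apply: eq_bigr => x _.
by rewrite big_seq1 !mulr1.
Qed.
Fact tens_mulDl : left_distributive tens_mul +%R.
Proof. by move=> x y z; apply: tens_prodDl; apply: mul_bilinear. Qed.
Fact tens_mulDr : right_distributive tens_mul +%R.
Proof. by move=> x y z; apply: tens_prodDr; apply: mul_bilinear. Qed.

HB.instance Definition _ := GRing.Zmodule_isPzRing.Build (tens A B)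
  tens_mulA tens_mul1l tens_mul1r tens_mulDl tens_mulDr.
End TensorAlgebra.

(* M (x)_O B as an A (x)_O B-module, with (a (x) b)(m (x) b') = am (x) bb'. *)
Definition base_change (O : comNzRingType) (A B : algType O) (M : lmodType A) :
  Type := tens (restrict M) B.

Section BaseChange.
Variables (O : comNzRingType) (A B : algType O) (M : lmodType A).

Notation MB := (base_change B M).

HB.instance Definition _ := GRing.Zmodule.on MB.

Definition restrict_act (a : A) (m : restrict M) : restrict M := a *: (m : M).

Fact restrict_act_bilinear : bilinear_for *:%R *:%R restrict_act.
Proof.
split=> [m c a b | a c m m']; rewrite /restrict_act /=.
  rewrite [LHS]scalerDl; congr (_ + _).
  by rewrite [RHS]scalerA -scalerAl mul1r.
rewrite [LHS]scalerDr; congr (_ + _).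
rewrite [LHS]scalerA [RHS]scalerA.
by rewrite -scalerAr -scalerAl mul1r mulr1.
Qed.

Definition base_change_scale : tens A B -> MB -> MB :=
  tens_prod restrict_act (@GRing.mul B).

Let scaleE := tens_prodE restrict_act_bilinear (mul_bilinear B).
Let mulE := tens_prodE (mul_bilinear A) (mul_bilinear B).

Fact base_change_scaleA x y z :
  base_change_scale x (base_change_scale y z) = base_change_scale (x * y) z.
Proof.
elim/tens_ind: x => s; elim/tens_ind: y => t; elim/tens_ind: z => r.
rewrite /base_change_scale (scaleE t r) [_ * _](mulE s t) !scaleE.
apply/tens_classP => Z b bb; rewrite !pairing_prod.
rewrite [RHS]big_allpairs_dep; apply: eq_bigr => x _.
rewrite [LHS]big_allpairs_dep; apply: eq_bigr => y _ /=.
apply: eq_bigr => z _; rewrite mulrA /restrict_act; congr (b _ _).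
exact: (@scalerA A M x.1 y.1 z.1).
Qed.
Fact base_change_scale1 : left_id 1 base_change_scale.
Proof.
elim/tens_ind=> s; rewrite /base_change_scale scaleE.
apply/tens_classP => Z b bb.
rewrite pairing_prod big_seq1; apply: eq_bigr => x _.
by rewrite mul1r /restrict_act [_ *: _]scale1r.
Qed.
Fact base_change_scaleDr : right_distributive base_change_scale +%R.
Proof.
by move=> x y z; apply: tens_prodDr;
   [exact: restrict_act_bilinear | exact: mul_bilinear].
Qed.
Fact base_change_scaleDl z : {morph base_change_scale^~ z : x y / x + y}.
Proof.
by move=> x y; apply: tens_prodDl;
   [exact: restrict_act_bilinear | exact: mul_bilinear].
Qed.

HB.instance Definition _ := GRing.Zmodule_isLmodule.Build (tens A B) MB
  base_change_scaleA base_change_scale1 base_change_scaleDr base_change_scaleDl.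
End BaseChange.

(* The fraction field as an O-algebra. *)
Section FractionAlgebra.
Variable O : idomainType.

Definition frac_scale (c : O) (x : {fraction O}) : {fraction O} :=
  @FracField.tofrac O c * x.

Fact frac_scaleA a b x : frac_scale a (frac_scale b x) = frac_scale (a * b) x.
Proof. by rewrite /frac_scale rmorphM mulrA. Qed.
Fact frac_scale1 : left_id 1 frac_scale.
Proof. by move=> x; rewrite /frac_scale rmorph1 mul1r. Qed.
Fact frac_scaleDr : right_distributive frac_scale +%R.
Proof. by move=> a x y; rewrite /frac_scale mulrDr. Qed.
Fact frac_scaleDl x : {morph frac_scale^~ x : a b / a + b}.
Proof. by move=> a b; rewrite /frac_scale rmorphD mulrDl. Qed.
HB.instance Definition _ := GRing.Zmodule_isLmodule.Build O {fraction O}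
  frac_scaleA frac_scale1 frac_scaleDr frac_scaleDl.

Fact frac_scaleAl (c : O) (x y : {fraction O}) : c *: (x * y) = (c *: x) * y.
Proof. exact: mulrA. Qed.
HB.instance Definition _ :=
  GRing.Lmodule_isLalgebra.Build O {fraction O} frac_scaleAl.

Fact frac_scaleAr (c : O) (x y : {fraction O}) : c *: (x * y) = x * (c *: y).
Proof. exact: mulrCA. Qed.
HB.instance Definition _ :=
  GRing.Lalgebra_isAlgebra.Build O {fraction O} frac_scaleAr.
End FractionAlgebra.

Section Pullback.
Variables (R : pzRingType) (X Y Z : lmodType R).
Variables (u : {linear X -> Z}) (v : {linear Y -> Z}).

Definition pullback_pred : {pred X * Y} := fun w => u w.1 == v w.2.

Fact pullback_submod_closed : submod_closed pullback_pred.
Proof.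
split=> [|a w w']; rewrite !unfold_in /=; first by rewrite !linear0.
by move=> /eqP uw /eqP uw'; rewrite !linearP uw uw'.
Qed.
HB.instance Definition _ :=
  GRing.isSubmodClosed.Build R (X * Y)%type pullback_pred
    pullback_submod_closed.

(* X x_Z Y = {(x, y) | u x = v y}. *)
Definition pullback : Type := {w : X * Y | w \in pullback_pred}.
HB.instance Definition _ := SubChoice.on pullback.
HB.instance Definition _ := [SubChoice_isSubLmodule of pullback by <:].

Definition pullback_snd_fun (w : pullback) : Y := (val w).2.
Fact pullback_snd_linear : linear pullback_snd_fun.
Proof. by []. Qed.
HB.instance Definition _ :=
  GRing.isLinear.Build R pullback Y *:%R pullback_snd_fun pullback_snd_linear.
Definition pullback_snd : {linear pullback -> Y} := pullback_snd_fun.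

(* The map W -> X x_Z Y, w |-> (i w, 0), for i : W -> X with u o i = 0. *)
Section Inl.
Variables (W : lmodType R) (i : {linear W -> X}) (ui : forall w, u (i w) = 0).

Fact pullback_inl_subproof w : (i w, 0) \in pullback_pred.
Proof. by rewrite unfold_in /= ui linear0. Qed.
Definition pullback_inl_fun (w : W) : pullback :=
  exist _ (i w, 0) (pullback_inl_subproof w).
Fact pullback_inl_linear : linear pullback_inl_fun.
Proof.
move=> a x y; apply: val_inj; apply: injective_projections => /=.
  by rewrite linearP.
by rewrite scaler0 addr0.
Qed.
HB.instance Definition _ :=
  GRing.isLinear.Build R W pullback *:%R pullback_inl_fun pullback_inl_linear.
Definition pullback_inl : {linear W -> pullback} := pullback_inl_fun.
End Inl.
End Pullback.

Definition left_ideal (R : pzRingType) (I : set R) : Prop :=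
  [/\ I 0, (forall x y, I x -> I y -> I (x + y))
    & (forall a x, I x -> I (a * x))].

Definition maximal_left_ideal (R : pzRingType) (I : set R) : Prop :=
  [/\ left_ideal I, ~ I 1
    & forall J : set R, left_ideal J -> I `<=` J -> ~ J 1 -> J = I].

Definition jacobson_radical (R : pzRingType) (x : R) : Prop :=
  forall I : set R, maximal_left_ideal I -> I x.

Definition principal_ideal (R : comNzRingType) (a : R) : set R :=
  [set x | exists b, x = b * a].

Definition adically_complete (O : comNzRingType) (pi : O) : Prop :=
  forall x : nat -> O,
    (forall n, principal_ideal (pi ^+ n) (x n.+1 - x n)) ->
    exists l : O, forall n, principal_ideal (pi ^+ n) (l - x n).

(* A principal ideal domain with exactly one maximal ideal (pi), which is
   nonzero, and complete for the (pi)-adic topology (separatedness is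
   automatic). *)
Definition complete_dvr (O : idomainType) : Prop :=
  (forall I : set O, left_ideal I -> exists a, I = principal_ideal a) /\
  exists pi : O,
    [/\ pi != 0,
        forall I : set O, maximal_left_ideal I <-> I = principal_ideal pi
      & adically_complete pi].

Definition surj (X Y : Type) (f : X -> Y) : Prop := forall y, exists x, f x = y.

Definition projective (R : pzRingType) (P : lmodType R) : Prop :=
  forall (X Y : lmodType R) (g : {linear X -> Y}) (f : {linear P -> Y}),
    surj g -> exists h : {linear P -> X}, lin_comp g h = f.

(* An epimorphism from a projective module with superfluous kernel. *)
Definition projective_cover (R : pzRingType) (P M : lmodType R)
    (p : {linear P -> M}) : Prop :=
  [/\ projective P, surj p
    & forall N : {pred P}, submod_closed N ->
        (forall x, exists y z, [/\ y \in N, p z = 0 & x = y + z]) ->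
        forall x, x \in N].

Definition free_of_finite_rank (O : nzRingType) (V : lmodType O) : Prop :=
  exists (n : nat) (f : {linear V -> 'rV[O]_n}), bijective f.

Definition is_order (O : comNzRingType) (A : algType O) : Prop :=
  free_of_finite_rank A.

Definition gorenstein_order (O : comNzRingType) (A : algType O) : Prop :=
  is_order A /\ projective (D ((A^c)^o : lmodType A^c)).

Section Lattices.
Variables (O : comNzRingType) (A : algType O).

Definition is_lattice (M : lmodType A) : Prop :=
  free_of_finite_rank (restrict M).

Definition indecomposable_lattice (M : lmodType A) : Prop :=
  [/\ is_lattice M, (exists x : M, x != 0)
    & forall (X Y : lmodType A) (f : {linear (X * Y)%type -> M}),
        is_lattice X -> is_lattice Y -> bijective f ->
        (forall x : X, x = 0) \/ (forall y : Y, y = 0)].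

Definition rad_Hom (M N : lmodType A) (f : {linear M -> N}) : Prop :=
  forall X : lmodType A, indecomposable_lattice X ->
  forall (g : {linear X -> M}) (h : {linear N -> X}),
    jacobson_radical (lin_comp h (lin_comp f g)).

Definition short_exact_lattices (L E M : lmodType A)
    (i : {linear L -> E}) (q : {linear E -> M}) : Prop :=
  [/\ is_lattice L, is_lattice E & is_lattice M] /\
  [/\ injective i, surj q & forall e, q e = 0 <-> exists l, i l = e].

Definition almost_split (L E M : lmodType A)
    (i : {linear L -> E}) (q : {linear E -> M}) : Prop :=
  [/\ short_exact_lattices i q,
      ~ (exists s : {linear M -> E}, lin_comp q s = lin_id M),
      indecomposable_lattice L,
      indecomposable_lattice M
    & forall X : lmodType A, indecomposable_lattice X ->
        forall f : {linear X -> M},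
          rad_Hom f <-> exists h : {linear X -> E}, lin_comp q h = f].

Definition factors_through (X Y Z : lmodType A)
    (f : {linear X -> Z}) (g : {linear Y -> Z}) : Prop :=
  exists h : {linear X -> Y}, f = lin_comp g h.

Section Setup.
Variables (M P : lmodType A) (p : {linear P -> M}).

(* L = D(Coker(Hom_A(p, A))) and its map to nu(P) = D(Hom_A(P, A)). *)
Definition lat_L : lmodType A := D (coker (Adual_map p)).
Definition lat_L_incl : {linear lat_L -> nu P} :=
  D_map (coker_proj (Adual_map p)).

Fact lat_L_inclK l : nu_map p (lat_L_incl l) = 0.
Proof.
apply: lin_ext => f; rewrite -[RHS](linear0 (l : {linear _ -> _})).
congr (l _); apply/coker_classP; exists f.
by rewrite subr0.
Qed.

Variable phi : {linear M -> nu M}.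

Definition lat_E : lmodType A := pullback (nu_map p) phi.
Definition lat_E_incl : {linear lat_L -> lat_E} :=
  pullback_inl phi lat_L_inclK.
Definition lat_E_proj : {linear lat_E -> M} := pullback_snd (nu_map p) phi.
End Setup.
End Lattices.

(* Main.v *)
(* Projectivity of M (x) K gives c != 0 in O, elements m_i of M and maps
   al_i : M -> A with c y = sum_i al_i(y) m_i.  For psi : X -> nu(M) and
   h : M -> X put T(psi, h) = sum_i psi(h(m_i))(al_i).  Then psi factors through
   nu(p) if and only if c divides T(psi, h) for all h: a dual basis of P gives one
   direction; for the other, h |-> T(psi, h) / c extends from Hom(M, X) to
   Hom(P, X), which contains it as a pure O-submodule.  Since
   T(phi f, h) = T(phi (f h), id_M), a map f : X -> M lifts to E as soon as all
   phi (f h) with f h in Rad End(M) factor through nu(p).  Conversely, as End(X)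
   is local, a map to M that is not in the radical is a split epimorphism, hence
   cannot lift to E when E -> M does not split. *)
Require Import Defs.
From HB Require Import structures.
From mathcomp Require Import all_boot all_order all_algebra ring.
From mathcomp Require Import boolp classical_sets.
Set Implicit Arguments.
Unset Strict Implicit.
Unset Printing Implicit Defensive.
Import GRing.Theory.
Local Open Scope ring_scope.

(** * Jacobson radical and discrete valuation rings *)

Local Open Scope classical_set_scope.

(** The form T comes from a duality. A map X -> nu(N) amounts to an O-linear functional on [Adual N]
    (x)_A X, and this tensor product maps to Hom_A(N, X) by sending g (x) v to the rank-one map z
    |-> g(z) v. For N = P this is an isomorphism. For N = M the element sum_i al_i (x) h(m_i) lies
    over c h, so T(psi, h) / c is the value at h of the functional that psi induces on Hom_A(M, X)
    over the fraction field. Asking that c divide T says that this functional takes values in O.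
    Purity of Hom(M, X) in Hom(P, X) rests on torsion-freeness of X: if a g = h p with a != 0, then
    g kills the kernel of p, hence factors through p. The same argument with A in place of X gives
    surjectivity of nu(p). Completeness of O enters through the locality of endomorphism rings: a
    polynomial in a given endomorphism that is idempotent modulo the uniformizer is corrected to a
    true idempotent by passing to a limit. *)

Lemma sub_maximal_left_ideal (R : pzRingType) (I : set R) :
  left_ideal I -> ~ I 1 -> exists2 J, maximal_left_ideal J & I `<=` J.
Proof.
(* [Zorn_bigcup] also tests the empty chain, whose union is empty; taking the union with [I] makes
   the property hold there too. *)
move=> idI I1; pose P J := left_ideal (I `|` J) /\ ~ (I `|` J) 1.
have [|J [[idJ J1] maxJ]] := @Zorn_bigcup R P.
  move=> F FP totF.
  have in1 x : (I `|` \bigcup_(X in F) X) x ->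
      I x \/ exists2 X, F X & (I `|` X) x.
    by case=> [|[X FX Xx]]; [left|right; exists X => //; right].
  have sub X x : F X -> (I `|` X) x -> (I `|` \bigcup_(X in F) X) x.
    by move=> FX [] ?; [left|right; exists X].
  have [I0 ID IM] := idI.
  split; last by case/in1=> // -[X /FP[_ +]].
  split=> [|x y|a x]; first by left.
  - move=> /in1 [Ix|[X FX Xx]] /in1 [Iy|[Y FY Yy]].
    + by left; apply: ID.
    + have [[_ YD _] _] := FP _ FY.
      by apply: (sub Y) => //; apply: YD => //; left.
    + have [[_ XD _] _] := FP _ FX.
      by apply: (sub X) => //; apply: XD => //; left.
    + have [XY|YX] := totF _ _ FX FY.
        have [[_ YD _] _] := FP _ FY.
        by apply: (sub Y) => //; apply: YD => //; case: Xx => ?; [left|right; apply: XY].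
      have [[_ XD _] _] := FP _ FX.
      by apply: (sub X) => //; apply: XD => //; case: Yy => ?; [left|right; apply: YX].
  - move=> /in1 [Ix|[X FX Xx]]; first by left; apply: IM.
    have [[_ _ XM] _] := FP _ FX.
    by apply: (sub X) => //; apply: XM.
exists (I `|` J) => [|x]; last by left.
split=> // K idK IJK K1.
have IK : I `|` K = K by rewrite setUidr // => x Ix; apply: IJK; left.
apply: contrapT => nKJ; apply: (maxJ K); last by rewrite /P IK.
rewrite properEneq; split=> [|x Jx]; last by apply: IJK; right.
by apply/eqP => JK; apply: nKJ; rewrite JK IK.
Qed.

Lemma jacobson_radicalP (R : pzRingType) (x : R) :
  jacobson_radical x <-> forall y, exists z, z * (1 - y * x) = 1.
Proof.
split=> [Jx y | Jx I [idI I1 maxI]]; last first.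
  apply: contrapT => Ix; have [I0 ID IM] := idI.
  pose K : set R := [set z | exists i y, I i /\ z = i + y * x].
  have K1 : K 1.
    apply: contrapT => K1; apply: Ix; rewrite -(maxI K) //.
    - by exists 0, 1; rewrite add0r mul1r.
    - split.
      + by exists 0, 0; rewrite mul0r addr0.
      + move=> _ _ [i [y [Ii ->]]] [i' [y' [Ii' ->]]].
        by exists (i + i'), (y + y'); rewrite mulrDl addrACA; split=> //; apply: ID.
      + move=> a _ [i [y [Ii ->]]]; exists (a * i), (a * y).
        by rewrite mulrDr mulrA; split=> //; apply: IM.
    - by move=> i Ii; exists i, 0; rewrite mul0r addr0.
  have [i [y [Ii e]]] := K1.
  have [z zx] := Jx y; apply: I1; rewrite -zx e addrK.
  exact: IM.
apply: contrapT => nz.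
pose I : set R := [set w | exists z, w = z * (1 - y * x)].
have idI : left_ideal I.
  split; first by exists 0; rewrite mul0r.
    by move=> _ _ [z ->] [z' ->]; exists (z + z'); rewrite mulrDl.
  by move=> a _ [z ->]; exists (a * z); rewrite mulrA.
have [|J maxJ IJ] := sub_maximal_left_ideal idI.
  by move=> [z e]; apply: nz; exists z.
have Jx' := Jx _ maxJ; have [[J0 JD JM] J1 _] := maxJ.
apply: J1; rewrite -(subrK (y * x) 1); apply: JD; last exact: JM.
by apply: IJ; exists 1; rewrite mul1r.
Qed.

Section DiscreteValuationRing.
Variables (O : idomainType) (pi : O).
Hypothesis pid : forall I : set O, left_ideal I -> exists a, I = principal_ideal a.
Hypothesis pi_neq0 : pi != 0.
Hypothesis max_pi :
  forall I : set O, maximal_left_ideal I <-> I = principal_ideal pi.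

Lemma principal_left_ideal (a : O) : left_ideal (principal_ideal a).
Proof.
split; first by exists 0; rewrite mul0r.
  by move=> _ _ [b ->] [c ->]; exists (b + c); rewrite mulrDl.
by move=> b _ [c ->]; exists (b * c); rewrite mulrA.
Qed.

Lemma uniformizer_dvd (a : O) : a \isn't a GRing.unit -> principal_ideal pi a.
Proof.
move=> a_nu; have [|J /max_pi -> aJ] := sub_maximal_left_ideal (principal_left_ideal a).
  by move=> [b /esym ba]; apply/(negP a_nu)/unitrPr; exists b; rewrite mulrC.
by apply: aJ; exists 1; rewrite mul1r.
Qed.

Lemma uniformizer_nunit : pi \isn't a GRing.unit.
Proof.
have [_ pi1 _] := (max_pi _).2 (erefl (principal_ideal pi)).
by apply/negP => u; apply: pi1; exists pi^-1; rewrite mulVr.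
Qed.

(** The intersection of the ideals (pi^n) is principal, say (g). Then g = b pi, and cancelling pi
    shows that b lies in the intersection again, so b = c g and g (1 - c pi) = 0; as pi is not a
    unit, g = 0. *)
Lemma uniformizer_powersep (a : O) :
  (forall n, principal_ideal (pi ^+ n) a) -> a = 0.
Proof.
move=> aI; pose I : set O := [set x | forall n, principal_ideal (pi ^+ n) x].
have [|g Ig] := pid (I := I).
  split=> [n|x y Ix Iy n|b x Ix n]; have [P0 PD PM] := principal_left_ideal (pi ^+ n).
  - exact: P0.
  - exact: PD.
  - exact: PM.
have: I g by rewrite Ig; exists 1; rewrite mul1r.
move=> Ig'; have [b] := Ig' 1%N; rewrite expr1 => gb.
have : I b.
  move=> n; have [c] := Ig' n.+1; rewrite gb exprSr mulrA => /(mulIf pi_neq0) ->.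
  by exists c.
rewrite Ig => -[c bc]; have : I a by [].
rewrite Ig => -[d ->].
have : g * (1 - c * pi) = 0.
  by rewrite mulrBr mulr1 {1}gb bc -mulrA mulrCA mulrA subrr.
move/eqP; rewrite mulf_eq0 => /orP[/eqP -> | ]; first by rewrite mulr0.
rewrite subr_eq0 => /eqP e.
by case/negP: uniformizer_nunit; apply/unitrPr; exists c; rewrite mulrC -e.
Qed.

Lemma uniformizer_power (a : O) : a != 0 ->
  exists n u, u \is a GRing.unit /\ a = u * pi ^+ n.
Proof.
move=> a0; have : exists n, ~ principal_ideal (pi ^+ n) a.
  apply: contrapT => /forallNP h; case/eqP: a0; apply: uniformizer_powersep => n.
  by apply: contrapT; apply: h.
have ex (Q : nat -> Prop) : (exists n, Q n) -> exists n, `[< Q n >].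
  by move=> [n /asboolP Qn]; exists n.
move=> /ex e; case: (ex_minnP e) => -[|n] /asboolP nP min_n.
  by case: nP; exists a; rewrite mulr1.
have : principal_ideal (pi ^+ n) a.
  apply: contrapT => /asboolP /min_n; by rewrite ltnn.
move=> [u au]; exists n, u; split=> //.
apply: contrapT => /negP /uniformizer_dvd [b ub]; apply: nP.
by exists b; rewrite au ub exprS mulrA.
Qed.

Lemma dvr_total_dvd (a b : O) : (exists c, a = c * b) \/ (exists c, b = c * a).
Proof.
have [->|/uniformizer_power[m [u [uu ->]]]] := eqVneq a 0.
  by left; exists 0; rewrite mul0r.
have [->|/uniformizer_power[n [v [uv ->]]]] := eqVneq b 0.
  by right; exists 0; rewrite mul0r.
wlog : m n u v uu uv / (n <= m)%N => [hw|nm].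
  have [nm|/ltnW mn] := leqP n m; first exact: hw.
  have [] := hw n m v u uv uu mn; [by right|by left].
left; exists (u * v^-1 * pi ^+ (m - n)).
by rewrite -{1}(subnK nm) exprD [RHS]mulrACA divrK.
Qed.
End DiscreteValuationRing.
Local Close Scope classical_set_scope.

(** * Modules over a discrete valuation ring *)

Definition to_linear (R : pzRingType) (U V : lmodType R) (f : U -> V)
    (f_lin : linear f) : {linear U -> V} :=
  HB.pack f (GRing.isLinear.Build R U V *:%R f f_lin).

Definition finitely_generated (O : pzRingType) (V : lmodType O) : Prop :=
  exists (n : nat) (v : 'I_n -> V), forall x, exists a : 'I_n -> O,
    x = \sum_i a i *: v i.

Lemma free_finitely_generated (O : nzRingType) (V : lmodType O) :
  free_of_finite_rank V -> finitely_generated V.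
Proof.
move=> [n [f [g fK gK]]]; exists n, (fun i => g (delta_mx 0 i)) => x.
exists (f x 0); apply: (can_inj fK); rewrite linear_sum {1}(row_sum_delta (f x)).
by apply: eq_bigr => i _; rewrite linearZ /= gK.
Qed.

Section ModulesOverDVR.
Variable O : idomainType.
Hypothesis pid :
  forall I : set O, left_ideal I -> exists a, I = principal_ideal a.
Hypothesis total_dvd :
  forall a b : O, (exists c, a = c * b) \/ (exists c, b = c * a).

(** Induction on the number [k] of coordinates that suffice to determine an element of [S]. The last
    of them takes its values on [S] in a principal ideal; an element [s] realizing the generator
    reduces the claim to those elements of [S] where this coordinate vanishes. Keeping [S] a subset
    of a fixed [V] lets the induction pass to smaller submodules without new types. *)
Lemma sub_finitely_generated (V : lmodType O) N (u : {linear V -> 'rV[O]_N})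
    (k : nat) (S : set V) :
    S 0 -> (forall a x y, S x -> S y -> S (a *: x + y)) ->
    (forall x, S x -> (forall i : 'I_N, (i < k)%N -> u x 0 i = 0) -> x = 0) ->
  exists (n : nat) (v : 'I_n -> V), (forall i, S (v i)) /\
    forall x, S x -> exists a : 'I_n -> O, x = \sum_i a i *: v i.
Proof.
elim: k S => [|k IHk] S S0 SP inj.
  exists 0%N, (fun _ => 0); split=> // x Sx; exists (fun=> 0); rewrite big_ord0.
  exact: inj.
have [kN|Nk] := ltnP k N; last first.
  apply: IHk => // x Sx x0; apply: inj => // i _; apply: x0.
  exact: leq_trans (ltn_ord i) Nk.
pose j := Ordinal kN; pose I : set O := [set b | exists2 x, S x & u x 0 j = b]%classic.
have [|b Ib] := pid (I := I).
  split; first by exists 0 => //; rewrite linear0 mxE.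
    move=> _ _ [x Sx <-] [y Sy <-]; exists (1 *: x + y); first exact: SP.
    by rewrite scale1r linearD mxE.
  move=> a _ [x Sx <-]; exists (a *: x + 0); first exact: SP.
  by rewrite addr0 linearZ mxE.
have: I b by rewrite Ib; exists 1; rewrite mul1r.
move=> [s Ss sb].
have [||x [Sx xj0] x0|n [v [Sv genv]]] :=
  IHk [set x | S x /\ u x 0 j = 0]%classic.
- by split=> //; rewrite linear0 mxE.
- move=> a x y [Sx xj] [Sy yj]; split; first exact: SP.
  by rewrite linearP !mxE xj yj mulr0 addr0.
- apply: inj => // i; rewrite ltnS leq_eqVlt => /orP[/eqP ik|/x0 //].
  by rewrite (_ : i = j) //; apply: val_inj.
(* Index 0, where [unlift] returns [None], carries the new generator [s]. *)
exists n.+1, (fun i => oapp v s (unlift ord0 i)); split.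
  by move=> i; case: unliftP => /= [l _|_ //]; have [] := Sv l.
move=> x Sx; have : I (u x 0 j) by exists x.
rewrite Ib => -[c xc].
have [|a xa] := genv (x - c *: s).
  rewrite addrC -scaleNr; split; first exact: SP.
  by rewrite linearP !mxE sb xc mulNr addNr.
exists (fun i => oapp a c (unlift ord0 i)); rewrite big_ord_recl unlift_none /=.
apply/eqP; rewrite addrC -subr_eq xa; apply/eqP/eq_bigr => i _.
by rewrite liftK.
Qed.

Lemma embedded_finitely_generated (V : lmodType O) N
    (u : {linear V -> 'rV[O]_N}) : injective u -> finitely_generated V.
Proof.
move=> u_inj; have [||x _ x0|n [v [_ genv]]] :=
  @sub_finitely_generated V N u N setT => //.
  apply: u_inj; rewrite linear0; apply/rowP => i; rewrite mxE; exact: x0.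
by exists n, v => x; apply: genv.
Qed.

Lemma common_divisor n (a : 'I_n.+1 -> O) :
  exists k, forall i, exists c, a i = c * a k.
Proof.
elim: n a => [|n IHn] a.
  by exists ord0 => i; exists 1; rewrite mul1r (ord1 i).
have [k ak] := IHn (fun i => a (lift ord0 i)).
have [[c ac]|[c ac]] := total_dvd (a ord0) (a (lift ord0 k)).
  exists (lift ord0 k) => i; case: (unliftP ord0 i) => [l ->|->]; first exact: ak.
  by exists c.
exists ord0 => i; case: (unliftP ord0 i) => [l ->|->].
  by have [d ->] := ak l; exists (d * c); rewrite ac mulrA.
by exists 1; rewrite mul1r.
Qed.

(* Generators of V modulo S that are minimal in number are free modulo S: in a
   nontrivial relation some coefficient divides all others, and by purity it can
   be divided out. *)
Lemma pure_complement (V : lmodType O) (S : set V) :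
    S 0 -> (forall a x y, S x -> S y -> S (a *: x + y)) ->
    (forall a x, a != 0 -> S (a *: x) -> S x) -> finitely_generated V ->
  exists (n : nat) (v : 'I_n -> V) (c : {linear V -> 'rV[O]_n}),
    (forall x, S (x - \sum_i c x 0 i *: v i)) /\
    forall y (a : 'rV[O]_n), S y -> c (y + \sum_i a 0 i *: v i) = a.
Proof.
move=> S0 SP Spure [n0 [v0 gen0]].
have SB x y : S x -> S y -> S (x - y).
  by move=> Sx Sy; rewrite addrC -scaleN1r; apply: SP.
pose G n := exists v : 'I_n -> V, forall x, exists a : 'I_n -> O,
   S (x - \sum_i a i *: v i).
have Gn0 : `[< G n0 >].
  apply/asboolP; exists v0 => x; have [a xa] := gen0 x; exists a.
  by rewrite -xa subrr.
case: (ex_minnP (ex_intro (fun n => `[< G n >]) n0 Gn0)) => n /asboolP[v genv] min_n.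
have free (a : 'rV[O]_n) : S (\sum_i a 0 i *: v i) -> a = 0.
  case: n v genv min_n a => [|n] v genv min_n a Sa; first by apply/rowP => -[].
  have [k ka] := common_divisor (a 0).
  have [ak0|ak0] := eqVneq (a 0 k) 0.
    by apply/rowP => i; rewrite mxE; have [c ->] := ka i; rewrite ak0 mulr0.
  have [b ab] := choice ka.
  have bk : b k = 1 by apply: (mulIf ak0); rewrite -ab mul1r.
  have Sb : S (\sum_i b i *: v i).
    apply: (Spure _ _ ak0); rewrite scaler_sumr; congr S: Sa.
    by apply: eq_bigr => i _; rewrite ab scalerA mulrC.
  have : (n.+1 <= n)%N.
    apply: min_n; apply/asboolP; exists (v \o lift k) => x.
    have [c Sc] := genv x; exists (fun i => c (lift k i) - c k * b (lift k i)).
    have := SP (c k) _ _ Sb Sc; congr S.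
    rewrite addrCA; congr (_ + _); apply: oppr_inj; rewrite opprD !opprK.
    rewrite [RHS](_ : _ = \sum_i (c i - c k * b i) *: v i); last first.
      by rewrite (bigD1_ord k) //= bk mulr1 subrr scale0r add0r.
    rewrite addrC scaler_sumr -sumrB; apply: eq_bigr => i _.
    by rewrite scalerBl scalerA.
  by rewrite ltnn.
(* The coordinates are merely chosen; freeness modulo [S] makes them unique, and uniqueness makes
   them linear. *)
have [c0 c0P] := choice genv; pose c x : 'rV[O]_n := \row_i c0 x i.
have cP x : S (x - \sum_i c x 0 i *: v i).
  rewrite (_ : \sum_i _ = \sum_i c0 x i *: v i) //.
  by apply: eq_bigr => i _; rewrite mxE.
have c_uniq x (a : 'rV[O]_n) : S (x - \sum_i a 0 i *: v i) -> c x = a.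
  move=> Sa; apply/eqP; rewrite -subr_eq0; apply/eqP/free.
  have := SB _ _ Sa (cP x); congr S.
  rewrite addrC opprB addrA subrK -sumrB; apply: eq_bigr => i _.
  by rewrite !mxE scalerBl.
have c_lin : linear c.
  move=> a x y; apply: c_uniq.
  have := SP a _ _ (cP x) (cP y); congr S.
  rewrite scalerBr addrACA -opprD; congr (_ - _).
  rewrite scaler_sumr -big_split; apply: eq_bigr => i _.
  by rewrite !mxE scalerA scalerDl.
exists n, v, (to_linear c_lin); split=> // y a Sy; apply: c_uniq.
by rewrite addrK.
Qed.

(** The zero submodule is pure because [V] embeds in a torsion-free module; generators that are free
    modulo 0 form a basis. *)
Lemma embedded_free (V : lmodType O) N (u : {linear V -> 'rV[O]_N}) :
  injective u -> free_of_finite_rank V.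
Proof.
move=> u_inj.
have [||a x a0 ax0|n [v [c [cS cK]]]] :=
  @pure_complement V [set 0]%classic _ _ _ (embedded_finitely_generated u_inj).
- by [].
- by move=> a x y -> ->; rewrite scaler0 addr0.
- apply: u_inj; rewrite linear0; apply/rowP => i.
  apply: (mulfI a0); have /rowP/(_ i) := congr1 u ax0.
  by rewrite linearZ linear0 !mxE mulr0.
exists n, c, (fun a : 'rV[O]_n => \sum_i a 0 i *: v i) => [x|a].
  by apply/esym/eqP; rewrite -subr_eq0; apply/eqP/cS.
by have := cK 0 a erefl; rewrite add0r.
Qed.

(** The image of [u] is pure, so it has a free complement. The extension is [xi] on the image and 0
    on the complement; [r] sends a vector to the preimage of its component in the image. *)
Lemma functional_extension (V W : lmodType O) (u : {linear W -> V})
    (xi : {linear W -> O^o}) :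
    finitely_generated V -> injective u ->
    (forall a x w, a != 0 -> a *: x = u w -> exists w', x = u w') ->
  exists zeta : {linear V -> O^o}, forall w, zeta (u w) = xi w.
Proof.
move=> fgV u_inj u_pure; pose S := [set u w | w in setT]%classic.
have SP a x y : S x -> S y -> S (a *: x + y).
  by move=> [w _ <-] [w' _ <-]; exists (a *: w + w') => //; rewrite linearP.
have S0 : S 0 by exists 0 => //; rewrite linear0.
have [|n [v [c [cS cK]]]] := pure_complement S0 SP _ fgV.
  by move=> a x a0 [w _ /esym] /(u_pure _ _ _ a0)[w' ->]; exists w'.
have /choice[r rP] x : exists w, u w = x - \sum_i c x 0 i *: v i.
  by have [w] := cS x; exists w.
have r_lin : linear (xi \o r).
  move=> a x y; rewrite /= -linearP; congr (xi _); apply: u_inj.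
  rewrite linearP !rP scalerBr addrACA -opprD; congr (_ - _).
  rewrite scaler_sumr -big_split; apply: eq_bigr => i _.
  by rewrite linearP !mxE scalerA scalerDl.
exists (to_linear r_lin).
move=> w /=; congr (xi _); apply: u_inj; rewrite rP.
have := cK (u w) 0; rewrite big1 ?addr0 => [->|i _]; last by rewrite mxE scale0r.
  by rewrite big1 ?subr0 // => i _; rewrite mxE scale0r.
by exists w.
Qed.
End ModulesOverDVR.

(** * Endomorphism rings of indecomposable lattices *)

Section MatricesOverCompleteDVR.
Variables (O : idomainType) (pi : O).
Hypothesis pi_dvd : forall a : O, a \isn't a GRing.unit -> principal_ideal pi a.
Hypothesis pi_nunit : pi \isn't a GRing.unit.
Hypothesis pi_sep : forall a : O, (forall n, principal_ideal (pi ^+ n) a) -> a = 0.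
Hypothesis pi_complete : adically_complete pi.

Lemma unit_1Bmul (a : O) : 1 - a * pi \is a GRing.unit.
Proof.
apply: contrapT => /negP /pi_dvd[b e]; case/negP: pi_nunit.
apply/unitrPr; exists (b + a); rewrite mulrC mulrDl -e.
by rewrite subrK.
Qed.

(** The determinant of 1 - tB is a polynomial in t with constant term 1, so its value at [pi] is
    congruent to 1 modulo [pi]. *)
Lemma unitmx_1Bscale n (B : 'M[O]_n) : 1%:M - pi *: B \in unitmx.
Proof.
pose q : {poly O} := \det (1%:M - 'X *: map_mx polyC B).
have qE x : q.[x] = \det (1%:M - x *: B).
  rewrite -/(horner_eval x q) -det_map_mx; congr (\det _).
  apply/matrixP => i j; rewrite !mxE /= /horner_eval !hornerE.
  by case: (i == j); rewrite ?mulr1n ?mulr0n !hornerE.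
have /factor_theorem[r qr] : root (q - 1) 0.
  by rewrite /root !hornerE qE scale0r subr0 det1 subrr.
rewrite unitmxE -qE -(subrK 1 q) qr !hornerE.
rewrite (_ : _ + 1 = 1 - (- r.[pi]) * pi); first exact: unit_1Bmul.
by ring.
Qed.

Variable n : nat.
Implicit Types A B C : 'M[O]_n.+1.

Definition scale_dvd m B := exists C, B = pi ^+ m *: C.

Lemma scale_dvdD m B C : scale_dvd m B -> scale_dvd m C -> scale_dvd m (B + C).
Proof. by move=> [B' ->] [C' ->]; exists (B' + C'); rewrite scalerDr. Qed.

Lemma scale_dvdN m B : scale_dvd m B -> scale_dvd m (- B).
Proof. by move=> [B' ->]; exists (- B'); rewrite scalerN. Qed.

Lemma scale_dvdMl m B C : scale_dvd m B -> scale_dvd m (C * B).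
Proof. by move=> [B' ->]; exists (C * B'); rewrite -scalerAr. Qed.

Lemma scale_dvdMr m B C : scale_dvd m B -> scale_dvd m (B * C).
Proof. by move=> [B' ->]; exists (B' * C); rewrite -scalerAl. Qed.

Lemma scale_dvdW m k B : (k <= m)%N -> scale_dvd m B -> scale_dvd k B.
Proof.
move=> km [C ->]; exists (pi ^+ (m - k) *: C).
by rewrite scalerA -exprD subnKC.
Qed.

Lemma scale_dvd_eq0 B : (forall m, scale_dvd m B) -> B = 0.
Proof.
move=> dB; apply/matrixP => i j; rewrite mxE; apply: pi_sep => m.
by have [C ->] := dB m; exists (C i j); rewrite mxE mulrC.
Qed.

Lemma scale_dvd_limit (x : nat -> 'M[O]_n.+1) :
    (forall m, scale_dvd m (x m.+1 - x m)) ->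
  exists l, forall m, scale_dvd m (l - x m).
Proof.
move=> dx; have /choice[l lP] ij :
    exists l, forall m, principal_ideal (pi ^+ m) (l - x m ij.1 ij.2).
  apply: pi_complete => m; have [C xC] := dx m; exists (C ij.1 ij.2).
  by have /matrixP/(_ ij.1 ij.2) := xC; rewrite !mxE mulrC.
exists (\matrix_(i, j) l (i, j)) => m.
have /choice[c cP] ij := lP ij m.
exists (\matrix_(i, j) c (i, j)); apply/matrixP => i j.
by rewrite !mxE (cP (i, j)) mulrC.
Qed.

Lemma unit_1B_scale_dvd B : scale_dvd 1 B -> 1 - B \in unitmx.
Proof. by move=> [C ->]; apply: unitmx_1Bscale. Qed.

(* Lifts the idempotent of O[X]/(pi, char_poly X) that splits off the part where
   X is nilpotent, by the Newton iteration e |-> 3e^2 - 2e^3. *)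
Lemma fitting_idempotent (X : 'M[O]_n.+1) :
  exists e, [/\ e * e = e, forall B, X * B = B * X -> e * B = B * e,
    e = 1 -> X \in unitmx & e = 0 -> 1 - X \in unitmx].
Proof.
pose chi := char_poly X.
pose phi : {rmorphism {poly O} -> 'M[O]_n.+1} := horner_mx X.
have phiZ c (r : {poly O}) : phi (c *: r) = c *: phi r by exact: linearZ.
have chi_monic : chi`_n.+1 \is a GRing.unit.
  have := char_poly_monic X; rewrite monicE lead_coefE size_char_poly => /eqP.
  by rewrite /chi => ->; rewrite unitr1.
(* Modulo [pi] the characteristic polynomial is a unit times h X^a, where a is the least index of a
   unit coefficient and h has constant term 1. Hence h X^a takes X into multiples of [pi], and w = 1
   - h is divisible by the indeterminate. *)
case: (ex_minnP (ex_intro (fun i => chi`_i \is a GRing.unit) n.+1 chi_monic)).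
move=> a chi_a min_a {chi_monic}.
have /choice[t0 t0P] i : exists b, (i < a)%N -> chi`_i = b * pi.
  have [ia|] := ltnP i a; last by exists 0.
  have [|b] := @pi_dvd chi`_i; last by exists b.
  by apply/negP => /min_a; rewrite leqNgt ia.
pose t := \poly_(i < a) t0 i.
pose h := (chi`_a)^-1 *: drop_poly a chi.
have chiE : chi = pi *: t + chi`_a *: h * 'X^a.
  rewrite /h scalerA divrr // scale1r -{1}(poly_take_drop a chi); congr (_ + _).
  apply/polyP => i; rewrite coef_take_poly coefZ coef_poly.
  by case: ltnP => [ia|]; rewrite ?mulr0 // t0P // mulrC.
have phi_Xh : scale_dvd 1 (phi (h * 'X^a)).
  exists (- (chi`_a)^-1 *: phi t).
  have E : chi`_a *: phi (h * 'X^a) = - (pi *: phi t).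
    apply/eqP; rewrite -addr_eq0 addrC -!phiZ -rmorphD /= scalerAl -chiE.
    by apply/eqP; apply: Cayley_Hamilton.
  rewrite -[LHS]scale1r -(mulVr chi_a) -scalerA E.
  by rewrite expr1 scaleNr !scalerN !scalerA mulrC.
have /factor_theorem[s] : root (1 - h) 0.
  rewrite /root !hornerE horner_coef0 coef_drop_poly.
  by rewrite mulVr ?subrr.
rewrite subr0 => sE.
pose w := 1 - h.
pose step (q : {poly O}) := 3 * q ^+ 2 - 2 * q ^+ 3.
(* The start w^(a+1) is divisible by X^(a+1) and is congruent to 1 modulo h, so q^2 - q is a
   multiple of h X^a. The exponent a+1 instead of a keeps a factor X when a = 0; the case e = 1
   below relies on it. *)
pose q m := iter m step (w ^+ a.+1).
have q0d : scale_dvd 1 (phi (q 0%N ^+ 2 - q 0%N)).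
  have -> : q 0%N ^+ 2 - q 0%N =
      - (w * s ^+ a * \sum_(i < a.+1) w ^+ i) * (h * 'X^a).
    rewrite /q /= (_ : _ - _ = w ^+ a.+1 * (w ^+ a.+1 - 1)); last by ring.
    rewrite subrX1; move: (\sum_(i < a.+1) w ^+ i) => S.
    rewrite exprS (_ : w ^+ a = s ^+ a * 'X^a); last by rewrite /w sE exprMn.
    by rewrite /w; ring.
  by rewrite rmorphM; apply: scale_dvdMl.
have qd m : scale_dvd m.+1 (phi (q m ^+ 2 - q m)).
  elim: m => // m IH.
  (* The defect q^2 - q is squared by each step, so precision doubles; a gain of one power of [pi]
     is all that is retained. *)
  have -> : q m.+1 ^+ 2 - q m.+1 = (q m ^+ 2 - q m) * (q m ^+ 2 - q m) *
      (4 * q m ^+ 2 - 4 * q m - 3).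
    by rewrite /q /= -/(q m) /step; ring.
  rewrite 2!rmorphM /=; apply: scale_dvdMr.
  have [C ->] := IH; rewrite -scalerAl -scalerAr scalerA -exprD.
  by apply: (@scale_dvdW (m.+1 + m.+1)); [by rewrite addnS ltnS leq_addr|exists (C * C)].
have qS m : scale_dvd m.+1 (phi (q m.+1) - phi (q m)).
  have -> : phi (q m.+1) - phi (q m) = phi ((q m ^+ 2 - q m) * (1 - 2 * q m)).
    by rewrite -rmorphB; congr (phi _); rewrite /q /= -/(q m) /step; ring.
  by rewrite rmorphM; apply: scale_dvdMr.
have [|e eP] := @scale_dvd_limit (fun m => phi (q m)).
  by move=> m; apply: scale_dvdW (qS m).
have phiC m B : X * B = B * X -> phi (q m) * B = B * phi (q m).
  by move=> XB; apply: comm_horner_mx.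
have e0 : scale_dvd 1 (e - phi (q 0%N)).
  rewrite -(subrK (phi (q 1%N)) e) -addrA; apply: scale_dvdD; [exact: eP|exact: qS].
exists e; split.
- apply/eqP; rewrite -subr_eq0; apply/eqP/scale_dvd_eq0 => m.
  have -> : e * e - e = (e - phi (q m)) * e + phi (q m) * (e - phi (q m)) +
     (phi (q m ^+ 2 - q m) - (e - phi (q m))).
    rewrite rmorphB expr2 rmorphM /= !(mulrBl, mulrBr) opprB.
    by rewrite !addrA !subrK.
  apply: scale_dvdD.
    by apply: scale_dvdD; [apply: scale_dvdMr|apply: scale_dvdMl].
  by apply: scale_dvdD; [apply: scale_dvdW (qd m)|apply: scale_dvdN].
(* The limit of polynomials in X commutes with whatever commutes with X; this will make the
   idempotent A-linear. *)
- move=> B XB; apply/eqP; rewrite -subr_eq0; apply/eqP/scale_dvd_eq0 => m.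
  have -> : e * B - B * e = (e - phi (q m)) * B - B * (e - phi (q m)).
    by rewrite mulrBl mulrBr (phiC m B XB) opprB addrA subrK.
  apply: scale_dvdD; [exact: scale_dvdMr|].
  by apply: scale_dvdN; apply: scale_dvdMl.
- move=> e1; have : phi (q 0%N) \in unitmx.
    have := unit_1B_scale_dvd e0; by rewrite e1 opprB addrC subrK.
  rewrite /q /= exprSr {2}/w sE mulrA rmorphM /= unitmx_mul => /andP[_].
  by rewrite /phi horner_mx_X.
(* Here 1 - w^(a+1) becomes invertible at X. It is a multiple of h, so h(X) is invertible, X^a is
   divisible by [pi], and 1 - X divides the unit 1 - X^a. *)
- move=> e0'; have phi_h : phi h \in unitmx.
    have : 1 - phi (q 0%N) \in unitmx.
      by apply: unit_1B_scale_dvd; rewrite -[phi _]opprK; apply: scale_dvdN; rewrite -sub0r -e0'.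
    rewrite -(rmorph1 phi) -rmorphB /= -opprB /q /= subrX1 {1}/w.
    by rewrite -mulNr opprB opprB addrCA subrr addr0 rmorphM /= unitmx_mul => /andP[].
  have Xa : scale_dvd 1 (X ^+ a).
    have := scale_dvdMl (phi h)^-1 phi_Xh.
    by rewrite rmorphM /= mulKr // rmorphXn /= horner_mx_X.
  have := unit_1B_scale_dvd Xa.
  by rewrite -opprB subrX1 -mulNr opprB unitmx_mul => /andP[].
Qed.
End MatricesOverCompleteDVR.

Lemma complete_dvr_total_dvd (O : idomainType) : complete_dvr O ->
  forall a b : O, (exists c, a = c * b) \/ (exists c, b = c * a).
Proof.
move=> [pid [pi [pi0 max_pi _]]] a b.
exact: (dvr_total_dvd pid pi0 max_pi).
Qed.

Section RestrictedMap.
Variables (O : comNzRingType) (A : algType O) (M N : lmodType A).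

Fact restrict_map_linear (u : {linear M -> N}) :
  linear (u : restrict M -> restrict N).
Proof. by move=> a x y; rewrite [LHS]linearD [u _]linearZ. Qed.

Definition restrict_map (u : {linear M -> N}) : {linear restrict M -> restrict N} :=
  to_linear (restrict_map_linear u).

Lemma restrict_scaleC (c : O) (a : A) (x : restrict M) :
  c *: (a *: (x : M) : restrict M) = a *: ((c *: x : restrict M) : M).
Proof.
rewrite [LHS]scalerA [RHS]scalerA.
apply: (congr1 (fun b : A => b *: (x : M))).
by rewrite -scalerAl -scalerAr mul1r mulr1.
Qed.
End RestrictedMap.

Section Kernel.
Variables (R : pzRingType) (U V : lmodType R) (u : {linear U -> V}).

Definition kernel_pred : {pred U} := fun x => u x == 0.

Fact kernel_submod_closed : submod_closed kernel_pred.
Proof.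
split=> [|a x y]; rewrite !unfold_in /=; first by rewrite linear0.
by move=> /eqP ux /eqP uy; rewrite linearP ux uy scaler0 addr0.
Qed.
HB.instance Definition _ :=
  GRing.isSubmodClosed.Build R U kernel_pred kernel_submod_closed.

Definition kernel : Type := {x : U | x \in kernel_pred}.
HB.instance Definition _ := SubChoice.on kernel.
HB.instance Definition _ := [SubChoice_isSubLmodule of kernel by <:].

Definition kernel_incl : {linear kernel -> U} := val.
End Kernel.

Section LatticesOverCompleteDVR.
Variables (O : idomainType) (A : algType O).
Hypothesis hO : complete_dvr O.

Lemma embedded_lattice (M : lmodType A) N (u : {linear restrict M -> 'rV[O]_N}) :
  injective u -> is_lattice M.
Proof. exact: (embedded_free hO.1 (complete_dvr_total_dvd hO)). Qed.

Lemma sub_lattice (M N : lmodType A) (u : {linear M -> N}) :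
  injective u -> is_lattice N -> is_lattice M.
Proof.
move=> u_inj [n [f /bij_inj f_inj]].
apply: (@embedded_lattice M n (lin_comp f (restrict_map u))).
exact: inj_comp f_inj u_inj.
Qed.

(** M is the direct sum of the kernels of e and 1 - e, which are lattices as submodules of M. *)
Lemma indecomposable_idempotent (M : lmodType A) (e : {linear M -> M}) :
    indecomposable_lattice M -> e * e = e -> e = 0 \/ e = 1.
Proof.
move=> [latM _ indM] ee.
have eK x : e (e x) = e x by rewrite -[in RHS]ee.
pose X := kernel e; pose Y := kernel (1 - e).
have f_lin : linear (fun w : X * Y => val w.1 + val w.2).
  by move=> a w w'; rewrite /= scalerDr addrACA.
have lat_ker (u : {linear M -> M}) : is_lattice (kernel u).
  by apply: (@sub_lattice _ _ (kernel_incl u)) => //; apply: val_inj.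
have inX m : m - e m \in kernel_pred e.
  by rewrite unfold_in linearB /= eK subrr.
have inY m : e m \in kernel_pred (1 - e).
  by rewrite unfold_in /= eK subrr.
pose sX m : kernel e := exist _ (m - e m) (inX m).
pose sY m : kernel (1 - e) := exist _ (e m) (inY m).
have [|||X0|Y0] := indM X Y (to_linear f_lin).
- exact: lat_ker.
- exact: lat_ker.
- exists (fun m => (sX m, sY m)) => [[x y]|m] /=.
    have /eqP ex := valP x; have := valP y; rewrite unfold_in /= subr_eq0 => /eqP ey.
    congr (_, _); apply: val_inj; rewrite /= linearD /= ex -ey add0r //.
    by rewrite addrK.
  by rewrite subrK.
- right; apply: lin_ext => m /=; have /(congr1 val) /= := X0 (sX m).
  by move/eqP; rewrite subr_eq0 => /eqP.
- left; apply: lin_ext => m /=; exact: (congr1 val (Y0 (sY m))).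
Qed.

(** In an O-basis, A-linear endomorphisms are the matrices that commute with all [S a], the matrices
    of the action of A. The idempotent attached to the matrix of [u] commutes with them, so it comes
    from an idempotent endomorphism of M, which is 0 or 1; inverses commute with them as well. *)
Lemma indecomposable_local (M : lmodType A) (u : {linear M -> M}) :
    indecomposable_lattice M ->
  (exists v, v * u = 1 /\ u * v = 1) \/ exists v, v * (1 - u) = 1.
Proof.
move=> indM; have [[n [f [g fK gK]]] [x0 x0N] _] := indM.
case: n => [|n] in f g fK gK *.
  by case/eqP: x0N; apply: (can_inj fK); rewrite !(thinmx0 (f _)).
have mxE (h : {linear restrict M -> restrict M}) :
    exists B : 'M[O]_n.+1, forall x, f (h x) = f x *m B.
  have h_lin : linear (f \o h \o g).
    by move=> a v w; rewrite /= (can2_linear fK gK) !linearP.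
  exists (lin1_mx (to_linear h_lin)) => x.
  by rewrite mul_rV_lin1 /= fK.
have scale_lin (a : A) : linear (fun x : restrict M => a *: (x : M) : restrict M).
  by move=> c x y; rewrite [LHS]scalerDr restrict_scaleC.
have /choice[S SE] (a : A) : exists B : 'M[O]_n.+1, forall x : M, f (a *: x) = f x *m B.
  have [B BE] := mxE (to_linear (scale_lin a)).
  by exists B => x; apply: BE.
have [X XE] := mxE (restrict_map u).
have mx_inj (B C : 'M[O]_n.+1) : (forall x : M, f x *m B = f x *m C) -> B = C.
  move=> BC; apply/row_matrixP => i; rewrite !rowE -[delta_mx _ _]gK.
  exact: BC.
have XS a : X * S a = S a * X.
  apply: mx_inj => x; rewrite !mulmxA -XE -!SE -XE; congr (f _).
  by rewrite /= linearZ.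
have endo B : (forall a, B * S a = S a * B) ->
    exists v : {linear M -> M}, forall x, f (v x) = f x *m B.
  move=> BS; have v_lin : linear (fun x : M => g (f x *m B) : M).
    move=> a x y; apply: (can_inj fK); rewrite gK linearD mulmxDl.
    rewrite [f (_ + _)]linearD gK; congr (_ + _).
    by rewrite !SE gK -!mulmxA; congr (_ *m _); rewrite [RHS]BS.
  by exists (to_linear v_lin) => x /=; rewrite gK.
pose hO' := hO; case: hO' => pid [pi [pi0 max_pi pi_complete]].
have [e [ee eC e1 e0]] := fitting_idempotent (uniformizer_dvd max_pi)
  (uniformizer_nunit max_pi) (uniformizer_powersep pid pi0 max_pi) pi_complete X.
have unitC (B C : 'M[O]_n.+1) : B \in unitmx -> B * C = C * B -> B^-1 * C = C * B^-1.
  move=> uB BC; apply: (mulrI uB); rewrite mulVKr // mulrA BC mulrK //.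
have [E EE] : exists E : {linear M -> M}, forall x, f (E x) = f x *m e.
  by apply: endo => a; apply: eC.
have [|E0|E1] := @indecomposable_idempotent M E indM.
- by apply: lin_ext => x; apply: (can_inj fK); rewrite /= !EE -mulmxA; congr (_ *m _).
- right; have uX : 1 - X \in unitmx.
    apply: e0; apply: mx_inj => x; rewrite -EE E0 mulmx0; exact: linear0.
  have [|v vE] := endo (1 - X)^-1.
    by move=> a; apply: unitC => //; rewrite mulrBl mulrBr mul1r mulr1 XS.
  exists v; apply: lin_ext => x; apply: (can_inj fK).
  rewrite [LHS]vE [f _]linearB /= XE -[X in X - _]mulmx1 -mulmxBr -mulmxA.
  by rewrite [_ *m _ ^-1]mulrV // mulmx1.
- left; have uX : X \in unitmx.
    by apply: e1; apply: mx_inj => x; rewrite -EE E1 mulmx1.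
  have [|v vE] := endo X^-1; first by move=> a; apply: unitC.
  exists v; split; apply: lin_ext => x; apply: (can_inj fK).
    by rewrite [LHS]vE /= XE -mulmxA [_ *m _^-1]mulrV // mulmx1.
  by rewrite [LHS]XE /= vE -mulmxA [_^-1 *m _]mulVr // mulmx1.
Qed.
End LatticesOverCompleteDVR.

(** * Dual bases *)

Lemma projective_dual_basis (R : pzRingType) (P : lmodType R) n (x : 'I_n -> P) :
    projective P -> (forall z, exists a : 'I_n -> R, z = \sum_i a i *: x i) ->
  exists s : {linear P -> 'rV[R]_n}, forall z, z = \sum_i s z 0 i *: x i.
Proof.
move=> projP gen.
have c_lin : linear (fun a : 'rV[R]_n => \sum_i a 0 i *: x i).
  move=> b u v; rewrite scaler_sumr -big_split; apply: eq_bigr => i _ /=.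
  by rewrite !mxE scalerDl scalerA.
have [|s sE] := projP _ _ (to_linear c_lin) (lin_id P).
  move=> z; have [a ->] := gen z; exists (\row_i a i) => /=.
  by apply: eq_bigr => i _; rewrite mxE.
by exists s => z; rewrite -[LHS]/(lin_id P z) -sE.
Qed.

Section Tensor.
Variables (O : comNzRingType) (M N : lmodType O).

Lemma tens_pureDl (m m' : M) (n : N) :
  tens_pure (m + m') n = tens_pure m n + tens_pure m' n.
Proof.
rewrite [RHS]tens_addE; apply/tens_classP => Z b [bl br].
rewrite /pairing /= !big_cons !big_nil !addr0 /=.
by rewrite -[m in LHS]scale1r bl /= scale1r.
Qed.

Lemma tens_pureZ (c : O) (m : M) (n : N) :
  tens_pure (c *: m) n = tens_pure m (c *: n).
Proof.
apply/tens_classP => Z b [bl br]; rewrite /pairing !big_seq1 /=.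
have b0l k : b 0 k = 0.
  by have := zmod_morphism_linear (bl k) 0 0; rewrite !subr0 subrr.
have b0r k : b k 0 = 0.
  by have := zmod_morphism_linear (br k) 0 0; rewrite !subr0 subrr.
by rewrite -[c *: m]addr0 bl b0l -[c *: n]addr0 br b0r.
Qed.

Lemma tens_cons (w : M * N) (s : seq (M * N)) :
  tens_class (w :: s) = tens_pure w.1 w.2 + tens_class s.
Proof. by rewrite [RHS]tens_addE; case: w. Qed.

Lemma tens_pure0l (n : N) : tens_pure (0 : M) n = 0.
Proof.
by apply: (@addrI _ (tens_pure 0 n)); rewrite -tens_pureDl !addr0.
Qed.
End Tensor.

Lemma fraction_num_den (O : idomainType) (k : {fraction O}) :
  exists d n : O, d != 0 /\ FracField.tofrac d * k = FracField.tofrac n.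
Proof.
elim/quotW: k => r; exists (\d_r), (\n_r); split; first exact: denom_ratioP.
rewrite /FracField.tofrac; unlock.
rewrite -[LHS]FracField.pi_mul; apply/eqP; rewrite FracField.equivf_def.
rewrite /FracField.equivf /FracField.mulf !numden_Ratio ?oner_eq0 ?mul1r ?denom_ratioP //.
by rewrite mulr1 mulrC.
Qed.

Section FractionTensor.
Variables (O : idomainType) (A : algType O).
Local Notation K := {fraction O}.
Local Notation frac := (@FracField.tofrac O).

(** Equality in [tens] can be tested on any bilinear map: the maps (v, k) |-> v_i k into the
    fraction field recover every coordinate. *)
Lemma tens_pure_inj (V : lmodType O) (x y : V) :
  free_of_finite_rank V -> tens_pure x (1 : K) = tens_pure y 1 -> x = y.
Proof.
move=> [n [f /bij_inj f_inj]] /tens_classP xy; apply: f_inj; apply/rowP => i.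
have b_bil : bilinear_for *:%R *:%R (fun v (k : K) => f v 0 i *: k : K).
  split=> u a v w /=; first by rewrite linearP !mxE scalerDl scalerA.
  by rewrite scalerDr !scalerA mulrC.
have := xy K _ b_bil; rewrite /pairing !big_seq1 /= => /eqP.
by rewrite [_ *: _]mulr1 [X in _ == X]mulr1 tofrac_eq => /eqP.
Qed.

Definition base_pure (a : A) : tens A K := tens_pure a 1.

Lemma base_pureD a b : base_pure (a + b) = base_pure a + base_pure b.
Proof. exact: tens_pureDl. Qed.

Lemma base_pure0 : base_pure 0 = 0.
Proof. exact: tens_pure0l. Qed.

Lemma tens_mul_pure (a b : A) (k l : K) :
  tens_pure a k * tens_pure b l = tens_pure (a * b) (k * l).
Proof. exact: (tens_prodE (mul_bilinear A) (mul_bilinear K)). Qed.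

Lemma base_pureM a b : base_pure (a * b) = base_pure a * base_pure b.
Proof. by rewrite /base_pure tens_mul_pure mulr1. Qed.

Lemma base_change_scale_pure (M : lmodType A) (a : A) (k l : K) (m : restrict M) :
  tens_pure a k *: (tens_pure m l : base_change K M) =
  tens_pure (a *: (m : M) : restrict M) (k * l).
Proof. exact: (tens_prodE (restrict_act_bilinear M) (mul_bilinear K)). Qed.

Lemma tens_denominator (t : tens A K) :
  exists (d : O) (a : A), d != 0 /\ base_pure d%:A * t = base_pure a.
Proof.
elim/tens_ind: t => s; elim: s => [|[a k] s [d [b [d0 sE]]]].
  by exists 1, 0; rewrite oner_neq0 base_pure0; split=> //; exact: mulr0.
have [e [n [e0 ke]]] := fraction_num_den k.
exists (d * e), (n *: (d *: a) + e *: b); split; first exact: mulf_neq0.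
rewrite tens_cons /= mulrDr base_pureD; congr (_ + _).
  rewrite tens_mul_pure mul1r -scalerAl mul1r mulrC -scalerA /base_pure !tens_pureZ.
  congr (tens_pure _ _); congr (_ *: _).
  by rewrite -[LHS]/(frac e * k) ke -[RHS]/(frac n * 1) mulr1.
rewrite mulrC -scalerA -[d *: 1]mul1r scalerAl.
by rewrite (base_pureM (e *: 1)) -mulrA sE -base_pureM -scalerAl mul1r.
Qed.

Lemma common_denominator (I : finType) (t : I -> tens A K) :
  exists (d : O) (a : I -> A), d != 0 /\ forall i, base_pure d%:A * t i = base_pure (a i).
Proof.
have /choice[e eP] i := tens_denominator (t i).
have /choice[b bP] i := eP i.
exists (\prod_i e i), (fun i => (\prod_(j | j != i) e j) *: b i); split.
  by apply/prodf_neq0 => i _; have [] := bP i.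
move=> i; have [_ tE] := bP i.
rewrite (bigD1 i) //= mulrC -scalerA -[_ *: 1 in LHS]mul1r scalerAl base_pureM -mulrA tE.
by rewrite -base_pureM -scalerAl mul1r.
Qed.
End FractionTensor.

Lemma tens_pure_sum (O : comNzRingType) (M N : lmodType O) (n : N) I (r : seq I)
    (F : I -> M) :
  tens_pure (\sum_(i <- r) F i) n = \sum_(i <- r) tens_pure (F i) n.
Proof.
elim: r => [|i r IH]; first by rewrite !big_nil; apply: tens_pure0l.
by rewrite !big_cons -IH; apply: tens_pureDl.
Qed.

(** O-generators m_i of M also generate M (x) K, and projectivity gives coordinate maps with values
    in A (x) K. The constant [c] is a common denominator of the coordinates of the finitely many
    m_j. Then c times any coordinate of an element of M comes from A, uniquely since A embeds in A
    (x) K, and uniqueness makes [al] linear. *)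
Lemma fraction_dual_basis (O : idomainType) (A : algType O) (M : lmodType A) :
    is_order A -> is_lattice M -> projective (base_change {fraction O} M) ->
  exists (c : O) (n : nat) (m : 'I_n -> M) (al : 'I_n -> {linear M -> A^o}),
    c != 0 /\ forall x, c%:A *: x = \sum_i (al i x : A) *: m i.
Proof.
move=> freeA freeM projMK.
have [n [m gen]] := free_finitely_generated freeM.
pose K := {fraction O}; pose MK := base_change K M.
pose mK (x : M) : MK := tens_pure (x : restrict M) (1 : K).
have base_pureZ a x : base_pure a *: mK x = mK (a *: x).
  by rewrite /mK base_change_scale_pure mulr1.
have mKD x y : mK (x + y) = mK x + mK y by apply: tens_pureDl.
have mK_sum (F : 'I_n -> M) : mK (\sum_i F i) = \sum_i mK (F i).
  exact: tens_pure_sum.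
have base_pure_comm (c : O) (a : A) :
    base_pure c%:A * base_pure a = base_pure a * base_pure c%:A.
  by rewrite -!base_pureM -scalerAl -scalerAr mul1r mulr1.
have [|s sE] := @projective_dual_basis _ MK n (fun i => mK (m i)) projMK.
  elim/tens_ind => w; elim: w => [|[x k] w [a wa]].
    by exists (fun=> 0); rewrite big1 // => i _; rewrite scale0r.
  have [b ->] := gen x.
  exists (fun i => tens_pure (b i)%:A k + a i).
  rewrite tens_cons /= tens_pure_sum [tens_class w]wa -big_split.
  apply: eq_bigr => i _; rewrite /= scalerDl; congr (_ + _).
  by rewrite base_change_scale_pure mulr1.
have [c [a [c0 aE]]] :=
  common_denominator (fun ij : 'I_n * 'I_n => s (mK (m ij.1)) 0 ij.2).
have /choice[al alE] (ix : 'I_n * M) :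
    exists b, base_pure c%:A * s (mK ix.2) 0 ix.1 = base_pure b.
  have [b xb] := gen ix.2; exists (\sum_j (b j)%:A * a (j, ix.1)).
  rewrite xb mK_sum linear_sum summxE mulr_sumr.
  rewrite (big_morph _ (@base_pureD O A) (@base_pure0 O A)).
  apply: eq_bigr => j _.
  rewrite -(base_pureZ (b j)%:A) linearZ mxE mulrA base_pure_comm -mulrA.
  by rewrite (aE (j, ix.1)) base_pureM.
have base_pure_inj (x y : A) : base_pure x = base_pure y -> x = y.
  exact: tens_pure_inj.
have al_lin i : linear (fun x : M => al (i, x) : A^o).
  move=> b x y; apply: base_pure_inj; rewrite -alE /= mKD -base_pureZ.
  rewrite linearP !mxE mulrDr mulrA base_pure_comm -mulrA (alE (i, x)) (alE (i, y)).
  by rewrite base_pureD base_pureM.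
exists c, n, m, (fun i => to_linear (al_lin i)); split=> // x.
apply: (tens_pure_inj freeM); rewrite -/(mK _) -base_pureZ (sE (mK x)) scaler_sumr.
rewrite -[RHS]/(mK _) mK_sum; apply: eq_bigr => i _.
by rewrite scalerA (alE (i, x)) base_pureZ.
Qed.

Lemma projective_cover_dual_basis (O : comNzRingType) (A : algType O)
    (M P : lmodType A) (p : {linear P -> M}) :
    is_lattice M -> projective_cover p ->
  exists (n : nat) (x : 'I_n -> P) (xi : 'I_n -> {linear P -> A^o}),
    forall z, z = \sum_i (xi i z : A) *: x i.
Proof.
move=> /free_finitely_generated[n [m gen]] [projP p_surj p_small].
have /choice[x px] i := p_surj (m i).
have [|s sE] := @projective_dual_basis _ P n x projP.
  move=> z; pose N : {pred P} := fun z => `[< exists a : 'I_n -> A, z = \sum_i a i *: x i >].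
  suff /asboolP : z \in N by [].
  apply: p_small z => [|z].
    split=> [|b u v]; first by apply/asboolP; exists (fun=> 0); rewrite big1 // => i _; rewrite scale0r.
    move=> /asboolP[a ->] /asboolP[a' ->]; apply/asboolP.
    exists (fun i => b * a i + a' i); rewrite scaler_sumr -big_split.
    by apply: eq_bigr => i _; rewrite /= scalerDl scalerA.
  have [b pzb] := gen (p z); exists (\sum_i (b i)%:A *: x i), (z - \sum_i (b i)%:A *: x i).
  split; first by apply/asboolP; exists (fun i => (b i)%:A).
    rewrite linearB linear_sum /= [p z]pzb; apply/eqP; rewrite subr_eq0; apply/eqP.
    by apply: eq_bigr => i _; rewrite linearZ /= px.
  by rewrite addrC subrK.
have xi_lin i : linear (fun z => s z 0 i : A^o).
  by move=> a u v; rewrite linearP !mxE.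
by exists n, x, (fun i => to_linear (xi_lin i)).
Qed.

(** * The Nakayama functor *)

Lemma linear_factor_surj (R : pzRingType) (P M X : lmodType R)
    (p : {linear P -> M}) (g : {linear P -> X}) :
    surj p -> (forall z, p z = 0 -> g z = 0) ->
  exists h : {linear M -> X}, lin_comp h p = g.
Proof.
move=> /choice[r rK] gker.
have gr z : g (r (p z)) = g z.
  by apply/eqP; rewrite -subr_eq0 -linearB; apply/eqP/gker; rewrite linearB rK subrr.
have h_lin : linear (g \o r).
  move=> a x y; rewrite /= -linearP -[in LHS](rK x) -[in LHS](rK y) -linearP.
  by rewrite gr.
by exists (to_linear h_lin); apply: lin_ext => z /=; rewrite gr.
Qed.

Section HomModule.
Variables (O : comNzRingType) (A : algType O) (M N : lmodType A).

Definition Hom_module : Type := {linear M -> N}.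
HB.instance Definition _ := GRing.Zmodule.on Hom_module.

Fact Hom_scale_linear (c : O) (f : {linear M -> N}) :
  linear (fun x => c%:A *: f x).
Proof.
move=> a x y; rewrite linearP scalerDr !scalerA; congr (_ *: _ + _).
by rewrite -scalerAl -scalerAr mul1r mulr1.
Qed.

Definition Hom_scale (c : O) (f : {linear M -> N}) : Hom_module :=
  to_linear (Hom_scale_linear c f).

Fact Hom_scaleA a b f : Hom_scale a (Hom_scale b f) = Hom_scale (a * b) f.
Proof. by apply: lin_ext => x /=; rewrite scalerA -scalerAl mul1r scalerA. Qed.
Fact Hom_scale1 : left_id 1 Hom_scale.
Proof. by move=> f; apply: lin_ext => x /=; rewrite !scale1r. Qed.
Fact Hom_scaleDr : right_distributive Hom_scale (+%R : _ -> _ -> Hom_module).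
Proof. by move=> a f g; apply: lin_ext => x /=; rewrite scalerDr. Qed.
Fact Hom_scaleDl f :
  {morph Hom_scale^~ f : a b / a + b >-> (a + b : Hom_module)}.
Proof. by move=> a b; apply: lin_ext => x /=; rewrite !scalerDl. Qed.
HB.instance Definition _ := GRing.Zmodule_isLmodule.Build O Hom_module
  Hom_scaleA Hom_scale1 Hom_scaleDr Hom_scaleDl.
End HomModule.

Section NakayamaFunctor.
Variables (O : comNzRingType) (A : algType O).

Definition nu_app (M : lmodType A) (xi : nu M) (f : {linear M -> A^o}) : O :=
  (xi : {linear restrict (Adual M : lmodType A^c) -> O^o}) f.

Lemma nu_ext (M : lmodType A) (xi xi' : nu M) : nu_app xi =1 nu_app xi' -> xi = xi'.
Proof. by move=> e; apply: lin_ext => f; apply: e. Qed.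

Lemma nu_appD (M : lmodType A) (xi xi' : nu M) f :
  nu_app (xi + xi') f = nu_app xi f + nu_app xi' f.
Proof. by []. Qed.

Lemma nu_app_suml (M : lmodType A) I (r : seq I) (xi : I -> nu M) f :
  nu_app (\sum_(i <- r) xi i) f = \sum_(i <- r) nu_app (xi i) f.
Proof. by elim/big_rec2: _ => [//|i x y _ <-]. Qed.

Lemma nu_app_sumr (M : lmodType A) I (r : seq I) (xi : nu M) (f : I -> Adual M) :
  nu_app xi (\sum_(i <- r) f i) = \sum_(i <- r) nu_app xi (f i).
Proof. exact: (linear_sum (xi : {linear restrict (Adual M : lmodType A^c) -> O^o})). Qed.

Lemma nu_appZ (M : lmodType A) (a : A) (xi : nu M) (f : Adual M) :
  nu_app (a *: xi) f = nu_app xi ((a : A^c) *: f).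
Proof. by []. Qed.

Lemma nu_app_scalar (M : lmodType A) (c : O) (xi : nu M) f :
  nu_app (c%:A *: xi) f = c * nu_app xi f.
Proof.
pose xi' := xi : {linear restrict (Adual M : lmodType A^c) -> O^o}.
by rewrite -[LHS]/(xi' (c *: (f : restrict (Adual M : lmodType A^c)))) linearZ.
Qed.

Lemma nu_app_map (M N : lmodType A) (p : {linear M -> N}) (xi : nu M) f :
  nu_app (nu_map p xi) f = nu_app xi (lin_comp f p).
Proof. by []. Qed.
End NakayamaFunctor.

Section LatticeHom.
Variables (O : idomainType) (A : algType O).
Hypothesis hO : complete_dvr O.

Lemma lattice_torsion_free (M : lmodType A) (c : O) (x : M) :
  is_lattice M -> c != 0 -> c%:A *: x = 0 -> x = 0.
Proof.
move=> [n [f /bij_inj f_inj]] c0 cx.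
apply: f_inj; rewrite [RHS]linear0; apply/rowP => i; apply: (mulfI c0).
have /rowP/(_ i) : c *: f x = 0 by rewrite -linearZ -(linear0 f); congr (f _).
by rewrite !mxE mulr0.
Qed.

Lemma D_scalar (N : lmodType A^c) (c : O) (xi : D N) (y : restrict N) :
  (c%:A *: xi : {linear restrict N -> O^o}) y =
  c * (xi : {linear restrict N -> O^o}) y.
Proof.
pose xi' := xi : {linear restrict N -> O^o}.
have E : ((c%:A : A) : A^c) = c *: (1 : A^c) by [].
have Ey : (((c%:A : A) : A^c) *: (y : N) : restrict N) = c *: y.
  by rewrite E -[RHS]/(restrict_scale c y).
have <- : xi' (c *: y) = c * xi' y by rewrite linearZ.
by rewrite -Ey.
Qed.

(** Evaluation at generators embeds the dual in a free module of finite rank. Finite generation is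
    the right input because the cokernel defining [lat_L] may have torsion. *)
Lemma D_lattice (N : lmodType A^c) :
  finitely_generated (restrict N) -> is_lattice (D N).
Proof.
move=> [n [v gen]].
have u_lin : linear (fun xi : restrict (D N) =>
    \row_i (xi : {linear restrict N -> O^o}) (v i)).
  move=> c x y; apply/rowP => i; rewrite !mxE [LHS]/=; congr (_ + _).
  exact: D_scalar.
apply: (embedded_lattice hO (u := to_linear u_lin)) => xi xi' /rowP e.
apply: lin_ext => x; have [a ->] := gen x; rewrite !linear_sum.
by apply: eq_bigr => i _; have := e i; rewrite !linearZ /= !mxE => ->.
Qed.

Variables (P : lmodType A) (n : nat) (x : 'I_n -> P).
Hypothesis gen : forall z, exists a : 'I_n -> A, z = \sum_i a i *: x i.

Lemma linear_ext_generators (X : lmodType A) (f g : {linear P -> X}) :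
  (forall i, f (x i) = g (x i)) -> f = g.
Proof.
move=> fg; apply: lin_ext => z; have [a ->] := gen z; rewrite !linear_sum.
by apply: eq_bigr => i _; rewrite !linearZ /= fg.
Qed.

Lemma Hom_finitely_generated (X : lmodType A) :
  is_lattice X -> finitely_generated (Hom_module P X).
Proof.
move=> [k [f /bij_inj f_inj]].
have u_lin : linear (fun h : Hom_module P X =>
    mxvec (\matrix_(j < n) f ((h : {linear P -> X}) (x j)))).
  move=> c g h; rewrite -linearP; congr mxvec; apply/row_matrixP => j.
  rewrite linearP /= !rowK -linearP; congr (f _).
apply: (embedded_finitely_generated hO.1 (u := to_linear u_lin)) => g h.
move=> /(can_inj mxvecK) /row_matrixP e; apply: linear_ext_generators => i.
by have := e i; rewrite !rowK => /f_inj.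
Qed.

Lemma Adual_finitely_generated : is_order A -> finitely_generated (restrict (Adual P : lmodType A^c)).
Proof.
move=> [k [f /bij_inj f_inj]].
have u_lin : linear (fun h : restrict (Adual P : lmodType A^c) =>
    mxvec (\matrix_(j < n) f ((h : {linear P -> A^o}) (x j)))).
  move=> c g h; rewrite -linearP; congr mxvec; apply/row_matrixP => j.
  rewrite linearP /= !rowK -linearP.
  rewrite (_ : Adual_scale_fun _ _ _ = c *: (g (x j) : A)) //.
  by have := scalerAr c (g (x j) : A) 1; rewrite mulr1 => ->.
apply: (embedded_finitely_generated hO.1 (u := to_linear u_lin)) => g h.
move=> /(can_inj mxvecK) /row_matrixP e; apply: linear_ext_generators => i.
by have := e i; rewrite !rowK => /f_inj.
Qed.
End LatticeHom.

(** * The divisibility criterion *)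

Lemma scalar_comm (O : comNzRingType) (A : algType O) (c : O) (a : A) :
  a * c%:A = c%:A * a.
Proof. by rewrite -scalerAr -scalerAl mulr1 mul1r. Qed.

Section Criterion.
Variables (O : idomainType) (A : algType O) (M P : lmodType A) (p : {linear P -> M}).
Hypotheses (hO : complete_dvr O) (p_surj : surj p).
Variables (k : nat) (x : 'I_k -> P) (xi : 'I_k -> {linear P -> A^o}).
Hypothesis xiP : forall z, z = \sum_j (xi j z : A) *: x j.
Variables (c : O) (n : nat) (m : 'I_n -> M) (al : 'I_n -> {linear M -> A^o}).
Hypothesis c_neq0 : c != 0.
Hypothesis alP : forall y, c%:A *: y = \sum_i (al i y : A) *: m i.

Definition trace_form (X : lmodType A) (psi : {linear X -> nu M}) (h : {linear M -> X}) : O :=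
  \sum_i nu_app (psi (h (m i))) (al i).

Lemma Adual_expand (f : {linear P -> A^o}) :
  f = \sum_j ((f (x j) : A) : A^c) *: (xi j : Adual P) :> Adual P.
Proof.
apply: lin_ext => z; rewrite [z in LHS]xiP linear_sum.
rewrite (_ : (\sum_j _ : {linear P -> A^o}) z = \sum_j xi j z * f (x j)).
  by apply: eq_bigr => j _; rewrite linearZ.
by elim/big_rec2: _ => [//|j a b _ <-].
Qed.

Lemma dvd_trace_form (X : lmodType A) (psi : {linear X -> nu M}) (h : {linear M -> X}) :
  factors_through psi (nu_map p) -> exists b, trace_form psi h = c * b.
Proof.
(* Expanding al_i p in the dual basis of P turns T into a double sum over i and j; for fixed j, the
   sum over i of al_i(p x_j) h(m_i) is c h(p x_j), which produces the factor [c]. *)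
move=> [theta ->]; exists (\sum_j nu_app (theta (h (p (x j)))) (xi j)).
rewrite mulr_sumr /trace_form.
transitivity (\sum_i \sum_j nu_app ((al i (p (x j)) : A) *: theta (h (m i))) (xi j)).
  apply: eq_bigr => i _.
  rewrite -[LHS]/(nu_app (theta (h (m i))) (lin_comp (al i) p)).
  by rewrite [lin_comp _ _]Adual_expand nu_app_sumr.
rewrite exchange_big; apply: eq_bigr => j _ /=.
rewrite -nu_app_suml -nu_app_scalar -2!linearZ alP !linear_sum.
congr (nu_app _ _); apply: eq_bigr => i _.
by rewrite (linearZZ h) (linearZZ theta).
Qed.

(** The rank-one map that represents the tensor g (x) v. *)
Definition smul_map (N X : lmodType A) (g : {linear N -> A^o}) (v : X) : N -> X :=
  fun z => (g z : A) *: v.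

Fact smul_map_linear (N X : lmodType A) (g : {linear N -> A^o}) (v : X) :
  linear (smul_map g v).
Proof. by move=> a y z; rewrite /smul_map linearP scalerDl scalerA. Qed.

(** The quotient [tau] of T by [c] extends to a functional [B] on Hom(P, X), and the lift of [psi]
    sends v to the functional g |-> B(g (x) v), with g (x) v read as a rank-one map. *)
Lemma factors_through_trace (X : lmodType A) (psi : {linear X -> nu M}) :
  is_lattice X -> (forall h, exists b, trace_form psi h = c * b) ->
  factors_through psi (nu_map p).
Proof.
move=> latX /choice[tau tauP].
have tau_lin : linear (tau : Hom_module M X -> O^o).
  move=> a g h; apply: (mulfI c_neq0); rewrite -tauP.
  rewrite [RHS]mulrDr [c * (a * _)]mulrCA -!tauP /trace_form mulr_sumr -big_split.
  apply: eq_bigr => i _ /=.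
  by rewrite linearD linearZ nu_appD nu_app_scalar.
have pull_lin : linear ((fun g => lin_comp g p) : Hom_module M X -> Hom_module P X).
  by move=> a g h; apply: lin_ext.
have [|||B BE] := functional_extension (complete_dvr_total_dvd hO)
    (u := to_linear pull_lin) (to_linear tau_lin).
- apply: (Hom_finitely_generated hO (x := x)) latX => z.
  by exists (xi^~ z).
- move=> g h gh; apply: lin_ext => y; have [z <-] := p_surj y.
  exact: (congr1 (fun f : {linear P -> X} => f z) gh).
- move=> a g h a0 agh.
  have agh' z : a%:A *: g z = h (p z).
    exact: (congr1 (fun f : {linear P -> X} => f z) agh).
  have [|g' <-] := @linear_factor_surj _ P M X p g p_surj; last by exists g'.
  move=> z pz; apply: (lattice_torsion_free latX a0).
  by rewrite agh' pz linear0.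
have theta_lin v : linear (fun g : restrict (Adual P : lmodType A^c) =>
    B (to_linear (smul_map_linear (g : {linear P -> A^o}) v)) : O^o).
  move=> a g h; rewrite -linearP; congr (B _); apply: lin_ext => z.
  rewrite /= /smul_map /= /Adual_scale_fun scalerDl scalerA; congr (_ *: _ + _).
  exact: scalar_comm.
have theta_lin2 : linear (fun v => (to_linear (theta_lin v) : nu P)).
  move=> a v w; apply: lin_ext => g; rewrite /= /D_scale_fun /= -linearD; congr (B _).
  apply: lin_ext => z; rewrite /= /smul_map /= /Adual_scale_fun scalerDr scalerA.
  by [].
exists (to_linear theta_lin2); apply: lin_ext => v; apply: nu_ext => be.
rewrite nu_app_map -[RHS]/(B (to_linear (smul_map_linear (lin_comp be p) v))).
have -> : to_linear (smul_map_linear (lin_comp be p) v) =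
    to_linear pull_lin (to_linear (smul_map_linear be v)).
  exact: lin_ext.
rewrite BE /=; apply: (mulfI c_neq0); rewrite -tauP /trace_form.
(* What remains is the expansion c be = sum_i al_i be(m_i) in the right module Hom(M, A), obtained
   by applying [be] to the expansion of c y. *)
rewrite -nu_app_scalar nu_appZ.
rewrite (_ : _ *: _ = \sum_i ((be (m i) : A) : A^c) *: (al i : Adual M)).
  rewrite nu_app_sumr; apply: eq_bigr => i _.
  by rewrite -nu_appZ /= /smul_map linearZ.
apply: lin_ext => y.
rewrite (_ : (\sum_i _ : {linear M -> A^o}) y = be (c%:A *: y)).
  by rewrite linearZ; apply: scalar_comm.
rewrite alP linear_sum.
transitivity (\sum_i (al i y : A) * be (m i)); last first.
  by apply: eq_bigr => i _; rewrite linearZ.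
by elim/big_rec2: _ => [//|j a b _ <-].
Qed.
End Criterion.

(** * Almost split sequences *)

Lemma coker_finitely_generated (O : comNzRingType) (A : algType O) (U V : lmodType A)
    (u : {linear U -> V}) :
  finitely_generated (restrict V) -> finitely_generated (restrict (coker u)).
Proof.
move=> [n [v gen]]; exists n, (fun i => coker_class u (v i)).
elim/coker_ind => y; have [a ya] := gen y; exists a.
rewrite -[LHS]/(restrict_map (coker_proj u) y) ya linear_sum.
by apply: eq_bigr => i _; rewrite linearZ.
Qed.

Fact pullback_fst_linear (R : pzRingType) (X Y Z : lmodType R)
    (u : {linear X -> Z}) (v : {linear Y -> Z}) :
  linear (fun w : pullback u v => (val w).1).
Proof. by []. Qed.

Section NakayamaSequence.
Variables (O : idomainType) (A : algType O) (M P : lmodType A) (p : {linear P -> M}).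
Hypotheses (hO : complete_dvr O) (ordA : is_order A).
Hypotheses (latM : is_lattice M) (cover_p : projective_cover p).

(** An element of nu(M) is a functional on Hom(M, A). Composition with [p] embeds Hom(M, A) as a
    pure submodule of Hom(P, A), so the functional extends. *)
Lemma nu_map_surj : surj (nu_map p).
Proof.
have p_surj : surj p by case: cover_p.
have [k [x [xi xiP]]] := projective_cover_dual_basis latM cover_p.
move=> eta.
have [|||zeta zetaE] := functional_extension (complete_dvr_total_dvd hO)
    (u := restrict_map (Adual_map p)) (eta : {linear restrict (Adual M : lmodType A^c) -> O^o}).
- apply: (Adual_finitely_generated hO (x := x)) ordA => z.
  by exists (xi^~ z).
- move=> f g fg; apply: lin_ext => y; have [z <-] := p_surj y.
  exact: (congr1 (fun f : {linear P -> A^o} => f z) fg).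
- move=> a f g a0 afg.
  have [|g' <-] := @linear_factor_surj _ P M A^o p f p_surj; last by exists g'.
  move=> z pz; have [n [e /bij_inj e_inj]] := ordA.
  have : a *: (f z : A) = 0.
    transitivity ((g : {linear M -> A^o}) (p z)); last by rewrite pz linear0.
    have E : (f z : A) * a%:A = (g : {linear M -> A^o}) (p z).
      exact: (congr1 (fun f : {linear P -> A^o} => f z) afg).
    by rewrite -E -scalerAr mulr1.
  move=> /(congr1 e); rewrite linearZ linear0 => /rowP ae; apply: e_inj.
  rewrite [RHS]linear0; apply/rowP => i; apply: (mulfI a0).
  by have := ae i; rewrite !mxE mulr0.
by exists (zeta : nu P); apply: lin_ext => f; apply: zetaE.
Qed.

Lemma lat_L_incl_inj : injective (lat_L_incl p).
Proof.
move=> l l' ll; apply: lin_ext; elim/coker_ind => f.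
exact: (congr1 (fun xi : nu P => nu_app xi f) ll).
Qed.

Lemma nu_map_ker (xi : nu P) : nu_map p xi = 0 -> exists l, lat_L_incl p l = xi.
Proof.
move=> xi0; pose xi' := xi : {linear restrict (Adual P : lmodType A^c) -> O^o}.
have [||l lE] := @linear_factor_surj O _ _ O^o
    (restrict_map (coker_proj (Adual_map p))) xi'.
- by elim/coker_ind => f; exists f.
- move=> f /coker_classP[g]; rewrite subr0 => ->.
  exact: (congr1 (fun e : nu M => nu_app e g) xi0).
exists (l : lat_L p); apply: lin_ext => f.
rewrite -[RHS]/(xi' f) -lE -[RHS]/(l (coker_class (Adual_map p) f)).
by rewrite -[LHS]/(l (coker_class (Adual_map p) f)).
Qed.

Lemma nu_lattice (N : lmodType A) n (x : 'I_n -> N) :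
  (forall z, exists a : 'I_n -> A, z = \sum_i a i *: x i) -> is_lattice (nu N).
Proof. by move=> gen; apply: D_lattice; rewrite //; apply: Adual_finitely_generated gen ordA. Qed.

Lemma nakayama_short_exact : short_exact_lattices (lat_L_incl p) (nu_map p).
Proof.
have [k [x [xi xiP]]] := projective_cover_dual_basis latM cover_p.
have genP z : exists a : 'I_k -> A, z = \sum_i a i *: x i by exists (xi^~ z).
have [n [m genM]] := free_finitely_generated latM.
have genM' z : exists a : 'I_n -> A, z = \sum_i a i *: m i.
  by have [a za] := genM z; exists (fun i => (a i)%:A).
split; split.
- apply: (D_lattice hO); apply: coker_finitely_generated.
  exact: Adual_finitely_generated genP ordA.
- exact: nu_lattice genP.
- exact: nu_lattice genM'.
- exact: lat_L_incl_inj.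
- exact: nu_map_surj.
- move=> e; split=> [/nu_map_ker //|[l <-]]; exact: lat_L_inclK.
Qed.

Variable phi : {linear M -> nu M}.

Lemma pair_lattice (X Y : lmodType A) :
  is_lattice X -> is_lattice Y -> is_lattice (X * Y)%type.
Proof.
move=> [k [f /bij_inj f_inj]] [l [g /bij_inj g_inj]].
have u_lin : linear (fun w : restrict (X * Y)%type =>
   row_mx (f (w : X * Y).1) (g (w : X * Y).2)).
  move=> a [x y] [x' y']; by rewrite scale_row_mx add_row_mx -!linearP.
apply: (embedded_lattice hO (u := to_linear u_lin)) => -[x y] [x' y'].
by move=> /eq_row_mx[/f_inj /= -> /g_inj /= ->].
Qed.

Lemma lat_E_short_exact : short_exact_lattices (lat_E_incl p phi) (lat_E_proj p phi).
Proof.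
have [[latL latP _] [incl_inj surj_nu exact_nu]] := nakayama_short_exact.
split; split=> //.
- have v_lin : linear (val : lat_E p phi -> nu P * M) by [].
  by apply: (@sub_lattice _ _ hO _ _ (to_linear v_lin)); [apply: val_inj|apply: pair_lattice].
- by move=> l l' ll; apply: incl_inj; exact: (congr1 (fun w => (val w).1) ll).
- move=> y; have [z zy] := surj_nu (phi y).
  have zP : (z, y) \in pullback_pred (nu_map p) phi by rewrite unfold_in /= zy.
  by exists (exist _ (z, y) zP).
- move=> e; split=> [e0|[l <-] //].
  have /eqP := valP e; rewrite [(val e).2]e0 linear0 => /exact_nu[l lE].
  by exists l; apply: val_inj; rewrite /= lE -e0 -surjective_pairing.
Qed.

(** The universal property of the pullback: lifting [f] to E means choosing the component in
    nu(P). *)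
Lemma lat_E_lift (X : lmodType A) (f : {linear X -> M}) :
  (exists h : {linear X -> lat_E p phi}, lin_comp (lat_E_proj p phi) h = f) <->
  factors_through (lin_comp phi f) (nu_map p).
Proof.
split=> [[h <-]|[h hE]].
  exists (lin_comp (to_linear (@pullback_fst_linear _ _ _ _ (nu_map p) phi)) h); apply: lin_ext => v.
  by have /eqP := valP (h v).
have hP v : (h v, f v) \in pullback_pred (nu_map p) phi.
  rewrite unfold_in; apply/eqP.
  exact: esym (congr1 (fun g : {linear X -> nu M} => g v) hE).
have k_lin : linear (fun v => exist _ (h v, f v) (hP v) : lat_E p phi).
  move=> a v w; by apply: val_inj; rewrite /= !linearP.
by exists (to_linear k_lin); apply: lin_ext.
Qed.
End NakayamaSequence.

(** The formula (1 - ab)^-1 = 1 + a (1 - ba)^-1 b, suggested by the geometric series, works for left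
    inverses and for maps between different modules. *)
Lemma left_invertible_swap (R : pzRingType) (X Y : lmodType R)
    (a : {linear X -> Y}) (b : {linear Y -> X}) :
  (exists z, z * (1 - lin_comp b a) = 1) -> exists z, z * (1 - lin_comp a b) = 1.
Proof.
move=> [z zE]; exists (1 + lin_comp a (lin_comp z b)); apply: lin_ext => v.
have zb w : z w - z (b (a w)) = w.
  by rewrite -linearB; apply: (congr1 (fun g : {linear X -> X} => g w) zE).
rewrite -[LHS]/(v - a (b v) + a (z (b (v - a (b v))))) !linearB /= -addrA.
by rewrite -linearB zb addNr addr0.
Qed.

(** Moving [g] to the front turns left invertibility of 1 - y h f g on X into that of 1 - (g y h) f
    on M, which is the radical condition for [f]. *)
Lemma rad_Hom_endo (O : comNzRingType) (A : algType O) (M : lmodType A)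
    (f : {linear M -> M}) : jacobson_radical f -> rad_Hom f.
Proof.
move=> /jacobson_radicalP fJ X indX g h; apply/jacobson_radicalP => y.
rewrite (_ : y * _ = lin_comp (lin_comp y (lin_comp h f)) g); last exact: lin_ext.
apply: left_invertible_swap; have [z zE] := fJ (lin_comp g (lin_comp y h)).
by exists z; rewrite -[RHS]zE; congr (_ * (_ - _)); apply: lin_ext.
Qed.

(** If y h f g is invertible on some indecomposable Y with inverse v, then f g v y h is an
    idempotent of End(M). It is nonzero because Y is, hence equals 1, and g v y h is a section of
    [f]. *)
Lemma not_rad_Hom_split (O : idomainType) (A : algType O) (X M : lmodType A)
    (f : {linear X -> M}) :
    complete_dvr O -> indecomposable_lattice M -> ~ rad_Hom f ->
  exists s : {linear M -> X}, lin_comp f s = lin_id M.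
Proof.
move=> hO indM nrad; apply: contrapT => nsplit; apply: nrad => Y indY g h.
apply/jacobson_radicalP => y.
pose u : {linear Y -> Y} := y * lin_comp h (lin_comp f g).
have [[v [vu uv]]|//] := indecomposable_local hO u indY.
pose e : {linear M -> M} := lin_comp (lin_comp f (lin_comp g v)) (lin_comp y h).
have uvK w : y (h (f (g (v w)))) = w.
  exact: (congr1 (fun k : {linear Y -> Y} => k w) uv).
have ee : e * e = e by apply: lin_ext => w; rewrite /= uvK.
have [e0|e1] := indecomposable_idempotent hO indM ee.
  have [_ [w /eqP w0] _] := indY; case: w0.
  have := congr1 (fun k : {linear M -> M} => k (f (g (v w)))) e0.
  by rewrite /= uvK => fgv0; rewrite -(uvK w) fgv0 !linear0.
case: nsplit; exists (lin_comp g (lin_comp v (lin_comp y h))).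
by rewrite -[RHS]e1; apply: lin_ext.
Qed.

Theorem proposition1p15 (O : idomainType) (A : algType O)
  (M P : lmodType A) (p : {linear P -> M})
  (hO : complete_dvr O)
  (hA : gorenstein_order A)
  (hM : indecomposable_lattice M)
  (hMnp : ~ projective M)
  (hMK : projective (base_change {fraction O} M))
  (hp : projective_cover p) :
  short_exact_lattices (lat_L_incl p) (nu_map p) /\
  forall phi : {linear M -> nu M},
    almost_split (lat_E_incl p phi) (lat_E_proj p phi) <->
    [/\ ~ factors_through phi (nu_map p),
        indecomposable_lattice (lat_L p)
      & forall f : {linear M -> M}, jacobson_radical f ->
          factors_through (lin_comp phi f) (nu_map p)].
Proof.
have latM : is_lattice M by case: hM.
have ordA : is_order A by case: hA.
split=> [|phi]; first exact: nakayama_short_exact.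
have lift X f := @lat_E_lift O A M P p phi X f.
have split_factors (s : {linear M -> lat_E p phi}) :
    lin_comp (lat_E_proj p phi) s = lin_id M -> factors_through phi (nu_map p).
  move=> qs; have -> : phi = lin_comp phi (lin_id M) by apply: lin_ext.
  by apply/lift; exists s.
split=> [[_ nsplit indL _ lift_rad]|[nfac indL phi_rad]].
  split=> // [phi_fac|f fJ].
    apply: nsplit; apply/lift.
    by have -> : lin_comp phi (lin_id M) = phi by apply: lin_ext.
  by apply/lift; apply/(lift_rad M hM); apply: rad_Hom_endo.
split=> // [|[s qs]|X indX f]; first exact: lat_E_short_exact.
  exact/nfac/(split_factors s).
have p_surj : surj p by case: hp.
have [k [x [xi xiP]]] := projective_cover_dual_basis latM hp.
have [c [n [m [al [c0 alP]]]]] := fraction_dual_basis ordA latM hMK.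
split=> [f_rad|[h qh]].
  apply/lift; apply: (factors_through_trace hO p_surj xiP c0 alP).
    by case: indX.
  (* The radical condition on [f] is tested with M itself as the auxiliary indecomposable lattice,
     which puts f h in the radical of End(M). *)
  move=> h; have /phi_rad : jacobson_radical (lin_comp f h).
    have -> : lin_comp f h = lin_comp (lin_id M) (lin_comp f h) by apply: lin_ext.
    exact: f_rad.
  (* T(phi f, h) and T(phi (f h), id) are convertible, so the divisibility obtained for the latter
     is the one required. *)
  exact: (dvd_trace_form xiP alP (lin_id M)).
apply: contrapT => /(not_rad_Hom_split hO hM)[s fs].
apply: nfac; apply: (split_factors (lin_comp h s)).
by rewrite -fs -qh; apply: lin_ext.
Qed.
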